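(* Let $\omega_{FS}$ be the Fubini-Study form on $\mathbb P^1$ and let $\mathbb D\subset\mathbb C$ be the open unit disc, with closure $\overline{\mathbb D}$. There exists a smooth family $(\phi_\tau)_{\tau\in\partial\mathbb D}$ of Kähler potentials on $(\mathbb P^1,\omega_{FS})$ such that the weak solution $\Phi$ on $\mathbb P^1\times\overline{\mathbb D}$ to the Dirichlet problem for the complex Homogeneous Monge-Ampère Equation $$\Phi(\cdot,\tau)=\phi_\tau(\cdot)\ \text{ for }\tau\in\partial\mathbb D,\qquad \pi_{\mathbb P^1}^*\omega_{FS}+dd^c\Phi\ge 0,\qquad (\pi_{\mathbb P^1}^*\omega_{FS}+dd^c\Phi)^{2}=0$$ is completely degenerate on some non-empty open subset $S\subset\mathbb P^1\times\mathbb D$, i.e. $$\pi_{\mathbb P^1}^*\omega_{FS}+dd^c\Phi\,|_S=0 .$$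
   Context: The operator $dd^c$ is normalised so that $dd^c\log|z|^2=\delta_0$ on $\mathbb C$ (i.e. $dd^c=\frac{i}{2\pi}\partial\bar\partial$). The Fubini-Study form is normalised so that $\int_{\mathbb P^1}\omega_{FS}=1$; thus $\omega_{FS}=dd^c\log(1+|z|^2)$ in the affine coordinate $z$ on $\mathbb C\subset\mathbb P^1$. The map $\pi_{\mathbb P^1}:\mathbb P^1\times\overline{\mathbb D}\to\mathbb P^1$ is the projection. A smooth family of Kähler potentials $(\phi_\tau)_{\tau\in\partial\mathbb D}$ means that each $\phi_\tau$ is a smooth real function on $\mathbb P^1$ with $\omega_{FS}+dd^c\phi_\tau>0$, and $\phi_\tau$ varies smoothly with $\tau\in\partial\mathbb D$. The Dirichlet problem has a unique weak solution, given by the envelope $$\Phi=\sup\{\psi:\mathbb P^1\times\overline{\mathbb D}\to\mathbb R\cup\{-\infty\}\ :\ \psi\text{ upper semicontinuous},\ \pi_{\mathbb P^1}^*\omega_{FS}+dd^c\psi\ge0,\ \psi(z,\tau)\le\phi_\tau(z)\text{ for }(z,\tau)\in\mathbb P^1\times\partial\mathbb D\},$$ where the inequality $\pi_{\mathbb P^1}^*\omega_{FS}+dd^c\psi\ge0$ is meant in the sense of currents on $\mathbb P^1\times\mathbb D$.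
   Formalization: In the envelope defining Φ, the functions ψ are also required to satisfy the sub-mean value inequality (to be π*ω_FS-plurisubharmonic); with upper semicontinuity and the current inequality alone, raising ψ at one interior point would make Φ = +∞ there. *)

(* Defs.v *)
From HB Require Import structures.
From mathcomp Require Import all_boot all_order all_algebra.
From mathcomp Require Import all_classical all_reals all_analysis.

Set Implicit Arguments.
Unset Strict Implicit.
Unset Printing Implicit Defensive.

Import Order.TTheory GRing.Theory Num.Theory.
Import numFieldNormedType.Exports.

Local Open Scope classical_set_scope.
Local Open Scope ring_scope.

(* C is modelled by R * R, with (x, y) standing for x + iy, and C^2 by
   (R * R) * (R * R). *)
Notation plane R := (R * R)%type.
Notation plane2 R := ((R * R) * (R * R))%type.

Definition sqmod (R : realType) (z : plane R) : R := z.1 ^+ 2 + z.2 ^+ 2.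

Definition cinv (R : realType) (z : plane R) : plane R :=
  (z.1 / sqmod z, - z.2 / sqmod z).

Definition mulI (R : realType) (z : plane R) : plane R := (- z.2, z.1).

Definition mulI2 (R : realType) (v : plane2 R) : plane2 R :=
  (mulI v.1, mulI v.2).

Definition disc (R : realType) : set (plane R) := [set t | sqmod t < 1].
Definition closed_disc (R : realType) : set (plane R) := [set t | sqmod t <= 1].
Definition circle (R : realType) : set (plane R) := [set t | sqmod t = 1].
Definition expi (R : realType) (t : R) : plane R := (cos t, sin t).

Definition P1 (R : realType) := one_point_compactification (plane R).

(* [chart false] is the affine coordinate z, [chart true] the coordinate
   w = 1/z centred at the point at infinity. *)
Definition chart (R : realType) (j : bool) (w : plane R) : P1 R :=
  if j then (if w == 0 then None else Some (cinv w)) else Some w.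

Definition chart_prod (R : realType) (j : bool) (p : plane2 R)
    : P1 R * plane R := (chart j p.1, p.2).

(* A function is C^k iff it is continuous and all its directional derivatives
   exist and are C^(k-1). *)
Fixpoint Ck (R : realType) (V : normedModType R) (k : nat) (f : V -> R)
    : Prop :=
  continuous f /\
  if k is k'.+1 then
    forall v : V, (forall x, derivable f x v) /\ Ck k' (fun x => 'D_v f x)
  else True.

Definition smooth (R : realType) (V : normedModType R) (f : V -> R) : Prop :=
  forall k, Ck k f.

(* For J the multiplication by i, this is the value (dd^c u)_x (xi, J xi) of
   the real (1,1)-form dd^c u = (i / 2 pi) d dbar u.  On C one has
   dd^c u = (4 pi)^-1 (u_xx + u_yy) dx /\ dy; in general restrict u to the
   complex line x + C xi.  A real (1,1)-form beta is determined by the values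
   beta (xi, J xi), and is positive iff they are. *)
Definition ddc (R : realType) (V : normedModType R) (J : V -> V) (u : V -> R)
    (x xi : V) : R :=
  (4 * pi)^-1 * ('D_xi (fun y => 'D_xi u y) x +
                 'D_(J xi) (fun y => 'D_(J xi) u y) x).

(* Local potential of the Fubini-Study form: omega_FS = dd^c fs_pot in each of
   the two charts (the two potentials differ by the pluriharmonic function
   log |z|^2 on the overlap). *)
Definition fs_pot (R : realType) (w : plane R) : R := ln (1 + sqmod w).

Definition smooth_P1 (R : realType) (f : P1 R -> R) : Prop :=
  forall j, smooth (fun w : plane R => f (chart j w)).

Definition kahler_potential (R : realType) (f : P1 R -> R) : Prop :=
  smooth_P1 f /\
  forall j (w xi : plane R), xi != 0 ->
    0 < ddc (@mulI R) (fun y : plane R => fs_pot y + f (chart j y)) w xi.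

(* Joint smoothness on P^1 x (unit circle), the circle being parametrised by
   the angle; phi need not be meaningful off the circle. *)
Definition smooth_family (R : realType) (phi : plane R -> P1 R -> R) : Prop :=
  forall j, smooth (fun q : plane R * R => phi (expi q.2) (chart j q.1)).

(* [measurableTypeR R] is R with the Borel sigma-algebra that carries the
   library's Lebesgue measure. *)
Definition leb2 (R : realType) :
    set (measurableTypeR R * measurableTypeR R) -> \bar R :=
  (@lebesgue_measure R \x @lebesgue_measure R)%E.

HB.instance Definition _ (R : realType) :=
  Measure.copy (@leb2 R) (@lebesgue_measure R \x @lebesgue_measure R)%E.

(* The library has no usable instance of sigma-finiteness for a product. *)
Lemma leb2_sigma_finite (R : realType) : sigma_finite setT (@leb2 R).
Proof.
have /sigma_finiteP[F [TF ndF Foo]] := sigma_finiteT (@lebesgue_measure R).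
exists (fun n => F n `*` F n).
  rewrite -setXTT TF predeqE => -[x y]; split.
    move=> [/= [n _ Fnx] [k _ Fky]]; exists (maxn n k) => //; split.
    - by move: x Fnx; exact/subsetPset/ndF/leq_maxl.
    - by move: y Fky; exact/subsetPset/ndF/leq_maxr.
  by move=> [n _ []/= ? ?]; split; exists n.
move=> k; have [mF Fk] := Foo k; split; first exact: measurableX.
by rewrite /leb2 product_measure1E// lte_mul_pinfty// ge0_fin_numE.
Qed.

HB.instance Definition _ (R : realType) :=
  Measure_isSigmaFinite.Build _ _ _ (@leb2 R) (@leb2_sigma_finite R).

Definition leb4 (R : realType) :
    {measure set ((measurableTypeR R * measurableTypeR R) *
                  (measurableTypeR R * measurableTypeR R))%type -> \bar R} :=
  (@leb2 R \x @leb2 R)%E.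

Definition test_fun (R : realType) (U : set (plane2 R)) (chi : plane2 R -> R)
    : Prop :=
  smooth chi /\
  exists K : set (plane2 R),
    [/\ compact K, K `<=` U & forall p, ~ K p -> chi p = 0].

Definition loc_integrable (R : realType) (U : set (plane2 R))
    (u : plane2 R -> \bar R) : Prop :=
  forall K : set (plane2 R), compact K -> K `<=` U -> (@leb4 R).-integrable K u.

(* The distribution T (xi, J xi), for T the current dd^c u on U and xi a
   constant vector, evaluated at chi. *)
Definition ddc_current (R : realType) (U : set (plane2 R))
    (u : plane2 R -> \bar R) (xi : plane2 R) (chi : plane2 R -> R) : \bar R :=
  (\int[@leb4 R]_(p in U) (u p * (ddc (@mulI2 R) chi p xi)%:E))%E.

Definition current_ge0 (R : realType) (U : set (plane2 R))
    (u : plane2 R -> \bar R) : Prop :=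
  loc_integrable U u /\
  forall xi chi, test_fun U chi -> (forall p, 0 <= chi p) ->
    (0 <= ddc_current U u xi chi)%E.

Definition current_eq0 (R : realType) (U : set (plane2 R))
    (u : plane2 R -> \bar R) : Prop :=
  loc_integrable U u /\
  forall xi chi, test_fun U chi -> ddc_current U u xi chi = 0%E.

(* Upper semicontinuity on the (not necessarily open) set A. *)
Definition usc_on (T : topologicalType) (R : realType) (A : set T)
    (f : T -> \bar R) : Prop :=
  forall x, A x -> forall a : R, (f x < a%:E)%E ->
    \forall y \near within A (nbhs x), (f y < a%:E)%E.

(* The sub-mean value inequality on every closed complex disc
   {x + zeta xi : |zeta| <= 1} contained in U. *)
Definition sub_mean_value (R : realType) (U : set (plane2 R))
    (u : plane2 R -> \bar R) : Prop :=
  forall x xi : plane2 R,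
    (forall zeta : plane R, closed_disc zeta ->
       U (x + (zeta.1 *: xi + zeta.2 *: mulI2 xi))) ->
    (u x <= ((2 * pi)^-1)%:E *
       \int[@lebesgue_measure R]_(t in `[0%R, (2 * pi)%R])
          u (x + ((cos t : R) *: xi + (sin t : R) *: mulI2 xi))%R)%E.

(* psi plus the local potential of pi^* omega_FS, read in the chart j: the
   current pi^* omega_FS + dd^c psi is dd^c of this function there. *)
Definition twist (R : realType) (psi : P1 R * plane R -> \bar R) (j : bool)
    (p : plane2 R) : \bar R :=
  ((fs_pot p.1)%:E + psi (chart_prod j p))%E.

(* The competitors of the envelope.  The condition pi^* omega_FS + dd^c psi >= 0
   only sees psi up to null sets, and raising a competitor at a single interior
   point preserves upper semicontinuity; so, as usual for
   quasi-plurisubharmonic functions, the condition includes that psi plus a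
   local potential is plurisubharmonic, and not merely almost everywhere equal
   to a plurisubharmonic function. *)
Definition competitor (R : realType) (phi : plane R -> P1 R -> R)
    (psi : P1 R * plane R -> \bar R) : Prop :=
  [/\ forall p, closed_disc p.2 -> (psi p < +oo)%E,
      usc_on [set p | closed_disc p.2] psi,
      forall j, current_ge0 [set p | disc p.2] (twist psi j),
      forall j, sub_mean_value [set p | disc p.2] (twist psi j) &
      forall z tau, circle tau -> (psi (z, tau) <= (phi tau z)%:E)%E].

Definition weak_solution (R : realType) (phi : plane R -> P1 R -> R)
    (p : P1 R * plane R) : \bar R :=
  ereal_sup [set psi p | psi in competitor phi].

(* The current pi^* omega_FS + dd^c Psi vanishes on S. *)
Definition completely_degenerate (R : realType)
    (Psi : P1 R * plane R -> \bar R) (S : set (P1 R * plane R)) : Prop :=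
  forall j, current_eq0 (chart_prod j @^-1` S) (twist Psi j).

(* Main.v *)
Require Import Defs.
From mathcomp Require Import all_boot all_order all_algebra.
From mathcomp Require Import all_classical all_reals all_analysis.
From mathcomp Require Import measurable_realfun ring lra.

Set Implicit Arguments.
Unset Strict Implicit.
Unset Printing Implicit Defensive.

Import Order.TTheory GRing.Theory Num.Theory.
Import numFieldNormedType.Exports.

Local Open Scope classical_set_scope.
Local Open Scope ring_scope.

(* For |tau| = 1 the function Q_tau(v) = (|v|^2 - Re(conj(tau) v^2)) / 2 is
   nonnegative and vanishes on the real line {v = tau conj(v)}.  The boundary
   data phi_tau are such that phi_tau + log(1 + |z|^2) equals
   log(theta(|z|^2)) + Q_tau(z) / (3 (20 + |z|^2)^2), where theta = 1 on [0, 1]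
   and theta(s) - 1 is flat at s = 1 and grows linearly at infinity: the first
   term is positively curved outside the unit disc and the second one near it.
   - For |b| <= 1/2 the holomorphic disc tau |-> (b + conj(b) tau, tau) has its
     boundary in the set where this potential vanishes, so by the maximum
     principle psi + log(1 + |z|^2) <= 0 on it for every competitor psi.  These
     discs sweep out an open set S.
   - log((1 + eps |z|^2) / (1 + 2 eps)) - log(1 + |z|^2), independent of tau, is
     a competitor for small eps; let eps tend to 0.
   Hence the envelope is -log(1 + |z|^2) on S, where the current vanishes. *)

(** * C^k functions *)

(** The line {v = tau conj(v)} makes half a turn as tau goes once round the circle. Comparing
    Fourier coefficients in f = tau conj(f) shows that the holomorphic f on the disc, continuous up
    to the circle, with boundary values in these lines are exactly the b + conj(b) tau: two real
    parameters, just enough for their graphs to fill an open set in real dimension four. The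
    obstacle is strict positivity of every boundary form although the potential attains its minimum
    0 along segments of these lines. Q_tau achieves this near the origin: its Laplacian is 2, since
    Re(conj(tau) v^2) is harmonic. But it grows quadratically and must be damped to extend over
    infinity; the square in (20 + |z|^2)^2 is dictated by the change of chart. The 20 delays the
    loss of positivity caused by damping until |z|^2 > 2, where log theta is already strictly
    curved, and the factor 1/3 keeps that loss below the curvature of log theta. Currents are tested
    through second differences, which pass from a function to the test function by translation
    invariance of Lebesgue measure. *)

Section Ck_calculus.
Context {R : realType} {V : normedModType R}.
Implicit Types (f g : V -> R) (k : nat).

(** The one-variable chain rule on the line through [x] in direction [v]; [f] is assumed
    differentiable along that direction only. *)
Lemma is_derive_comp (g : R -> R) f x v df dg :
  is_derive x v f df -> is_derive (f x) 1 g dg ->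
  is_derive x v (fun y => g (f y)) (dg * df).
Proof.
move=> [/derivable1P fd fE] [gd gE].
have f0 : f (0 *: v + x) = f x by rewrite scale0r add0r.
have gd' : derivable g (f (0 *: v + x)) 1 by rewrite f0.
have dc := derive1_comp fd gd'.
have cd : derivable (g \o (fun h : R => f (h *: v + x))) 0 1.
  move/derivable1_diffP in fd.
  move/derivable1_diffP in gd'.
  have D := differentiable_comp fd gd'.
  by apply/derivable1_diffP; exact: D.
split; first by apply/derivable1P.
have lim1 (F : V -> R) : 'D_v F x = ((fun h : R => F (h *: v + x))^`())%classic 0.
  rewrite derive1E /derive; set g1 := fun h => h^-1 *: _; set g2 := fun h => h^-1 *: _.
  suff -> : g1 = g2 by [].
  by apply/funext => h; rewrite /g1 /g2/= addr0 scale0r add0r [_%:A]mulr1.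
rewrite lim1 [LHS]dc derive1E f0 gE; congr (_ * _).
by rewrite -lim1.
Qed.

Lemma Ck_continuous k f : Ck k f -> continuous f.
Proof. by case: k => [|k] []. Qed.

(** Working form of the recursive definition: each closure property supplies an explicit family [df]
    of directional derivatives, and the induction on [k] runs on that family. *)
Lemma CkS k f (df : V -> V -> R) : continuous f ->
  (forall v x, is_derive x v f (df v x)) -> (forall v, Ck k (df v)) ->
  Ck k.+1 f.
Proof.
move=> cf dfE dfk; split=> // v; split=> [x|]; first by case: (dfE v x).
by rewrite (_ : (fun x => _) = df v)//; apply/funext => x; case: (dfE v x).
Qed.

Lemma CkS_derive k f v x : Ck k.+1 f -> is_derive x v f ('D_v f x).
Proof. by move=> [_ /(_ v)[fd _]]; exact/derivableP. Qed.

Lemma CkS_Ck k f v : Ck k.+1 f -> Ck k (fun x => 'D_v f x).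
Proof. by move=> [_ /(_ v)[]]. Qed.

Lemma CkW k f : Ck k.+1 f -> Ck k f.
Proof.
elim: k f => [|k ih] f Hf; first by split=> //; exact: (Ck_continuous Hf).
apply: (CkS (df := fun v x => 'D_v f x)).
- exact: Ck_continuous Hf.
- by move=> v x; exact: CkS_derive Hf.
- by move=> v; apply/ih/CkS_Ck.
Qed.

Lemma Ck_cst k (c : R) : Ck k (fun _ : V => c).
Proof.
elim: k c => [|k ih] c; first by split=> //; exact: cst_continuous.
refine (CkS (df := fun _ _ => 0) _ _ _).
- exact: cst_continuous.
- by move=> _; exact: ih.
Qed.

Lemma is_derive_linear f v x :
  (forall v x (h : R), f (h *: v + x) = h * f v + f x) -> is_derive x v f (f v).
Proof.
move=> fl.
have lim1 : (fun h : R => h^-1 *: ((f \o shift x) (h *: v) - f x)) @ 0^' --> f v.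
  apply: cvg_near_cst; near=> h.
  have h0 : h != 0 by near: h; exact: nbhs_dnbhs_neq.
  by rewrite /= fl addrK scalerA mulVf// scale1r.
by split; [apply/cvg_ex; exists (f v)|exact/cvg_lim].
Unshelve. all: by end_near. Qed.

Lemma Ck_linear k f : continuous f ->
  (forall v x (h : R), f (h *: v + x) = h * f v + f x) -> Ck k f.
Proof.
case: k => [|k] cf fl; first by split.
refine (CkS (df := fun v _ => f v) cf _ _) => [v x|v].
  exact: is_derive_linear.
exact: Ck_cst.
Qed.

Lemma CkD k f g : Ck k f -> Ck k g -> Ck k (fun x => f x + g x).
Proof.
elim: k f g => [|k ih] f g Hf Hg; have cf := Ck_continuous Hf;
  have cg := Ck_continuous Hg.
  by split=> // x; apply: continuousD; [exact: cf|exact: cg].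
apply: (CkS (df := fun v x => 'D_v f x + 'D_v g x)).
- by move=> x; apply: continuousD; [exact: cf|exact: cg].
- by move=> v x; apply: is_deriveD; [exact: CkS_derive Hf|exact: CkS_derive Hg].
- by move=> v; apply: ih; exact: CkS_Ck.
Qed.

Lemma CkM k f g : Ck k f -> Ck k g -> Ck k (fun x => f x * g x).
Proof.
elim: k f g => [|k ih] f g Hf Hg; have cf := Ck_continuous Hf;
  have cg := Ck_continuous Hg.
  by split=> // x; apply: continuousM; [exact: cf|exact: cg].
apply: (CkS (df := fun v x => f x * 'D_v g x + g x * 'D_v f x)).
- by move=> x; apply: continuousM; [exact: cf|exact: cg].
- by move=> v x; apply: is_deriveM; [exact: CkS_derive Hf|exact: CkS_derive Hg].
- by move=> v; apply: CkD; apply: ih; (exact: CkS_Ck) || exact: CkW.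
Qed.

Lemma CkV k f : (forall x, f x != 0) -> Ck k f -> Ck k (fun x => (f x)^-1).
Proof.
move=> f0; elim: k => [|k ih] Hf; have cf := Ck_continuous Hf.
  by split=> // x; apply: cvgV; [exact: f0|exact: cf].
apply: (CkS (df := fun v x => (-1) * ((f x)^-1 * (f x)^-1) * 'D_v f x)).
- by move=> x; apply: cvgV; [exact: f0|exact: cf].
- move=> v x; have fd := CkS_derive v x Hf; split; first exact: derivableV.
  by rewrite deriveV//; rewrite mulN1r -invfM.
- move=> v; apply: CkM; last exact: CkS_Ck.
  by apply: CkM; [exact: Ck_cst|apply: CkM; apply: ih; exact: CkW].
Qed.

Lemma Ck_ln k f : (forall x, 0 < f x) -> Ck k f -> Ck k (fun x => ln (f x)).
Proof.
move=> f0 Hf; have cf := Ck_continuous Hf.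
have cl : continuous (fun x => ln (f x)).
  move=> x; apply: (continuous_comp (f := f) (g := @ln R)); first exact: cf.
  exact: continuous_ln.
case: k Hf => [|k] Hf; first by split.
apply: (CkS (df := fun v x => (f x)^-1 * 'D_v f x)) => //.
- move=> v x; apply: is_derive_comp; first exact: CkS_derive Hf.
  exact: is_derive1_ln.
- move=> v; apply: CkM; last exact: CkS_Ck.
  by apply: CkV; [move=> x; rewrite gt_eqF|exact: CkW].
Qed.

End Ck_calculus.

Lemma Ck_comp {R : realType} {V : normedModType R} k (g : R^o -> R) (f : V -> R) :
  Ck k g -> Ck k f -> Ck k (fun x => g (f x)).
Proof.
elim: k g f => [|k ih] g f Hg Hf; have cf := Ck_continuous Hf;
  have cg := Ck_continuous Hg.
  by split=> // x; apply: continuous_comp; [exact: cf|exact: cg].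
apply: (CkS (df := fun v x => 'D_1 g (f x) * 'D_v f x)).
- by move=> x; apply: continuous_comp; [exact: cf|exact: cg].
- move=> v x; apply: is_derive_comp; first exact: CkS_derive Hf.
  exact: CkS_derive Hg.
- move=> v; apply: CkM; last exact: CkS_Ck.
  by apply: (ih (fun y => 'D_1 g y)); [exact: CkS_Ck|exact: CkW].
Qed.

Section sin_cos.
Context {R : realType}.

Lemma Ck_sin_cos k : Ck k (sin : R^o -> R) /\ Ck k (cos : R^o -> R).
Proof.
have dv (f : R^o -> R) (df : R -> R) (v x : R^o) :
    is_derive x 1 f (df x) -> is_derive x v f (v * df x).
  move=> fd; rewrite mulrC.
  apply: (@is_derive_comp _ _ (f : R -> R) id x v) => //.
elim: k => [|k [ihs ihc]].
  by split; split=> //; [exact: continuous_sin|exact: continuous_cos].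
split.
  refine (@CkS R R^o k sin (fun v x => v * cos x) _ _ _).
    exact: continuous_sin.
  by move=> v; apply: CkM => //; exact: Ck_cst.
refine (@CkS R R^o k cos (fun v x => v * (- sin x)) _ _ _).
    exact: continuous_cos.
  by move=> v x; apply: (dv cos (fun x => - sin x)).
move=> v; apply: CkM; first exact: Ck_cst.
under eq_fun do rewrite -mulN1r.
by apply: CkM => //; exact: Ck_cst.
Qed.

End sin_cos.

(** * Smooth functions flat at the origin *)

Section flat.
Context {R : realType}.
Implicit Types (x : R) (n : nat).

(* [flat 0] is the classical smooth function vanishing exactly on the
   nonpositive reals; the powers of 1/x make the family stable under d/dx. *)
Definition flat n x : R := if 0 < x then x^-1 ^+ n * expR (- x^-1) else 0.

Lemma flat_ge0 n x : 0 <= flat n x.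
Proof.
rewrite /flat; case: ifPn => // x0.
by rewrite mulr_ge0 ?expR_ge0// exprn_ge0// invr_ge0 ltW.
Qed.

Lemma flat_le0 n x : x <= 0 -> flat n x = 0.
Proof. by move=> x0; rewrite /flat ltNge x0. Qed.

(** With y = 1/x this is y^(n+2) / (n+2)! <= e^y. A quadratic bound is what makes the derivative at
    0 exist and vanish. *)
Lemma flat_le n x : flat n x <= (n.+2)`!%:R * `|x| ^+ 2.
Proof.
rewrite /flat; case: ifPn => x0; last first.
  by rewrite mulr_ge0// exprn_ge0.
have y0 : 0 < x^-1 by rewrite invr_gt0.
rewrite (gtr0_norm x0) expRN ler_pdivrMr ?expR_gt0//.
have := expR_ge1Dxn n.+1 (ltW y0); set F := _%:R => H.
have F0 : 0 < F by rewrite ltr0n fact_gt0.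
have : x^-1 ^+ n.+2 / F <= expR x^-1 by apply: le_trans H; rewrite lerDr.
rewrite ler_pdivrMr// => H2.
rewrite mulrAC -ler_pdivrMr ?exprn_gt0//.
by rewrite -exprVn -exprD addn2 mulrC.
Qed.

Lemma is_derive_flat n x :
  is_derive x 1 (flat n) (flat n.+2 x - n%:R * flat n.+1 x).
Proof.
have [x0|x0|<-] := ltgtP 0 x.
- have xn0 : x != 0 by rewrite gt_eqF.
  have h1 : \near x, x^-1 ^+ n * expR (- x^-1) = flat n x.
    near=> y; rewrite /flat ifT//; near: y; exact: lt_nbhsr.
  apply: near_eq_is_derive h1 _.
  have dV : is_derive (x : R^o) 1 (fun y : R => y^-1) (- x ^- 2).
    apply: DeriveDef; first exact: derivableV.
    by rewrite deriveV// derive_id; exact: mulr1.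
  have dE : is_derive x 1 (fun y : R => expR (- y^-1)) (expR (- x^-1) * x ^- 2).
    refine (@is_derive_comp _ _ expR (fun y : R => - y^-1) x 1 (x ^- 2) _ _ _).
    by apply: is_derive_eq; rewrite opprK.
  have -> : (fun y : R => y^-1 ^+ n * expR (- y^-1)) =
      ((fun y : R => y^-1) ^+ n) * (fun y : R => expR (- y^-1)).
    by apply/funext => y; rewrite /GRing.mul/= exprfctE.
  apply: is_derive_eq.
  rewrite /flat x0 -exprVn exprfctE; set E := expR _.
  transitivity (x^-1 ^+ n * (E * x^-1 ^+ 2) +
    E * ((n%:R * x^-1 ^+ n.-1) * - x^-1 ^+ 2)); first by [].
  case: n => [|n]/=; first by rewrite !expr0; ring.
  by rewrite !exprS; move: (x^-1) E (n.+1%:R : R) => y E m; ring.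
- have h1 : \near x, 0 = flat n x.
    near=> y; rewrite flat_le0//; apply: ltW; near: y; exact: lt_nbhsl.
  apply: near_eq_is_derive h1 _.
  rewrite !flat_le0 ?ltW// mulr0 subr0; exact: is_derive_cst.
(* At the origin the difference quotient is at most a constant times [|h|], by [flat_le]. *)
- rewrite !flat_le0// mulr0 subr0.
  have L : (fun h : R => h^-1 *: ((flat n \o shift 0) (h *: 1) - flat n 0)) @ 0^'
      --> (0 : R).
    apply/cvgr0Pnorm_le => /= e e0; near=> h.
    have h0 : h != 0 by near: h; exact: nbhs_dnbhs_neq.
    rewrite [flat n 0]flat_le0// subr0 /= addr0 [h%:A]mulr1 normrM normfV.
    rewrite ler_pdivrMl ?normr_gt0// ger0_norm ?flat_ge0//.
    apply: (le_trans (flat_le _ _)); rewrite expr2 mulrCA ler_wpM2l//.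
    have F0 : 0 < (n.+2)`!%:R :> R by rewrite ltr0n fact_gt0.
    rewrite mulrC -ler_pdivlMr//; near: h.
    exact/dnbhs0_le/divr_gt0.
  by split; [apply/cvg_ex; exists 0|exact/cvg_lim].
Unshelve. all: by end_near. Qed.

Lemma Ck_flat k n : Ck k (flat n : R^o -> R).
Proof.
have cf m : continuous (flat m).
  move=> x; apply: differentiable_continuous; apply/derivable1_diffP.
  by case: (is_derive_flat m x).
elim: k n => [|k ih] n; first by split=> //; exact: cf.
apply: (CkS (df := fun v x => (flat n.+2 x + (- n%:R) * flat n.+1 x) * v)).
- exact: cf.
- move=> v x; apply: (@is_derive_comp _ _ (flat n) id x v) => //.
  by rewrite mulNr; exact: is_derive_flat.
- move=> v; apply: CkM; last exact: Ck_cst.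
  by apply: CkD => //; apply: CkM => //; exact: Ck_cst.
Qed.

End flat.

(** * Lebesgue measure on C^2 *)

Section leb4_theory.
Context {R : realType}.
Notation mR := (measurableTypeR R).
Notation T4 := ((mR * mR) * (mR * mR))%type.

(** Rational cubes form a countable base of the topology of C^2, and each is a measurable rectangle;
    they link open sets to the product sigma-algebra. *)
Definition qball (i : (rat * rat) * (rat * rat) * nat) : set (plane2 R) :=
  (ball (ratr i.1.1.1 : R) i.2.+1%:R^-1 `*` ball (ratr i.1.1.2 : R) i.2.+1%:R^-1)
  `*` (ball (ratr i.1.2.1 : R) i.2.+1%:R^-1 `*` ball (ratr i.1.2.2 : R) i.2.+1%:R^-1).

Lemma measurable_qball i : measurable (qball i : set T4).
Proof. by do !apply: measurableX; exact: measurable_ball. Qed.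

Lemma open_measurable4 (U : set (plane2 R)) : open U -> measurable (U : set T4).
Proof.
move=> oU; pose D := [set i | qball i `<=` U].
suff -> : U = \bigcup_i (if `[< D i >] then qball i else set0).
  apply: (@countable_bigcupT_measurable _ T4) => // i.
  by case: ifPn => _; [exact: measurable_qball|exact: measurable0].
rewrite eqEsubset; split => [[[a b] [c d]] Up|p [i _]]; last first.
  by case: ifPn => // /asboolP; exact.
have /nbhs_ballP[e/= e0 eU] : nbhs ((a, b), (c, d)) U by exact: open_nbhs_nbhs.
have [n ne] : exists n, n.+1%:R^-1 < e :> R.
  have [N _ H] := near_infty_natSinv_lt (PosNum e0).
  by exists N; exact: (H N (leqnn N)).
(* Half of 1/(n+1): a cube of this radius around a rational point near [x] stays within 2/(2n+2) <
   [e] of [x]. *)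
have rd (x : R) : exists q : rat, ball (ratr q : R) (2 * n).+2%:R^-1 x.
  have /rat_in_itvoo[q] : x < x + (2 * n).+2%:R^-1 by rewrite ltrDl invr_gt0.
  rewrite in_itv/= => /andP[xq qx]; exists q.
  by rewrite /ball/= gtr0_norm ?subr_gt0// ltrBlDl.
have [[q1 h1] [q2 h2] [q3 h3] [q4 h4]] := And4 (rd a) (rd b) (rd c) (rd d).
exists ((q1, q2), (q3, q4), (2 * n).+1) => //.
have tri (q x y : R) : ball q (2 * n).+2%:R^-1 x -> ball q (2 * n).+2%:R^-1 y ->
    ball x e y.
  move=> /ball_sym qx qy; apply: le_ball (ball_triangle qx qy).
  apply: le_trans (ltW ne); rewrite -mulr2n -[X in X *+ _]div1r.
  rewrite -mulr_natr mul1r (_ : (2 * n).+2 = n.+1 * 2)%N; last by rewrite mulnC.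
  by rewrite mul1r natrM invfM -[leLHS]mulr_natr -mulrA mulVf ?mulr1.
rewrite ifT//; apply/asboolP => -[[x y] [z t]] /= [[/= hx hy] [/= hz ht]].
by apply: eU; split; split => /=; [exact: tri hx|exact: tri hy|exact: tri hz|exact: tri ht].
Qed.

Lemma continuous_measurable4 (f : plane2 R -> R) : continuous f ->
  measurable_fun setT (f : T4 -> R).
Proof.
move=> /continuousP cf.
apply: (measurability _ (RGenOpens.measurableE R)).
move=> _ [_ [a [b ->] <-]]; rewrite setTI; apply: open_measurable4.
exact/cf/interval_open.
Qed.

Lemma compact_measurable4 (K : set (plane2 R)) : compact K ->
  measurable (K : set T4).
Proof.
move=> /compact_closed cK; rewrite -[K]setCK; apply: measurableC.
apply: open_measurable4; apply: closed_openC; apply: cK.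
exact: norm_hausdorff.
Qed.

Definition box (M : R) : set (plane2 R) :=
  (`[- M, M]%classic `*` `[- M, M]%classic) `*` (`[- M, M]%classic `*` `[- M, M]%classic).

Lemma measurable_box M : measurable (box M : set T4).
Proof. by apply: measurableX; apply: measurableX; exact: measurable_itv. Qed.

Lemma leb4_box M : (@leb4 R (box M) < +oo)%E.
Proof.
have h : (@lebesgue_measure R `[- M, M]%classic%R < +oo)%E.
  by rewrite lebesgue_measure_itv/=; case: ifP => // _; rewrite -EFinB ltry.
rewrite /leb4 /= product_measure1E; [|by apply: measurableX; exact: measurable_itv..].
have h2 : (@leb2 R (`[- M, M]%classic%R `*` `[- M, M]%classic%R) < +oo)%E.
  rewrite /leb2 product_measure1E; [|exact: measurable_itv..].
  by rewrite lte_mul_pinfty// ge0_fin_numE.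
by rewrite lte_mul_pinfty// ge0_fin_numE.
Qed.

Lemma compact_sub_box (K : set (plane2 R)) : compact K ->
  exists M, K `<=` box M.
Proof.
move=> /compact_bounded [M [_ MK]]; exists (M + 1) => -[[x y] [z t]] Kp.
have {MK} := MK (M + 1) _ _ Kp; rewrite ltrDl ltr01 => /(_ isT).
rewrite /Num.norm/= !ge_max => /andP[/andP[hx hy] /andP[hz ht]].
by split; split => /=; rewrite in_itv/= -ler_norml.
Qed.

Lemma lebesgue_measure_translate (a : R) (X : set mR) : measurable X ->
  lebesgue_measure ((fun x : R => x + a) @^-1` X) = lebesgue_measure X.
Proof.
move=> mX; have ma : measurable_fun [set: mR] (fun x : R => x + a : mR).
  exact: measurable_funD.
apply/esym; apply: (@lebesgue_measure_unique R (pushforward lebesgue_measure (fun x : mR => (x : R) + a : mR))) => //.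
move=> _ [[b c] _ <-].
transitivity (lebesgue_measure `]b - a, c - a]%classic); last first.
  congr (lebesgue_measure _).
  by apply/seteqP; split => x /=; rewrite !in_itv/= ltrBlDr lerBrDr.
rewrite !lebesgue_measure_itv/= !lte_fin ltrD2r; case: ifPn => // _.
by rewrite -!EFinB opprB addrA subrK.
Qed.

(** Stated for arbitrary factors because it is iterated: from the line to the plane, then from the
    plane to C^2. *)
Lemma product_measure_map d1 d2 (T1 : measurableType d1) (T2 : measurableType d2)
    (m1 : {sigma_finite_measure set T1 -> \bar R})
    (m2 : {sigma_finite_measure set T2 -> \bar R}) (f1 : T1 -> T1) (f2 : T2 -> T2) :
  measurable_fun setT f1 -> measurable_fun setT f2 ->
  (forall A, measurable A -> m1 (f1 @^-1` A) = m1 A) ->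
  (forall A, measurable A -> m2 (f2 @^-1` A) = m2 A) ->
  let F := fun p : T1 * T2 => (f1 p.1, f2 p.2) in
  measurable_fun setT F /\
  forall X, measurable X -> (m1 \x m2)%E (F @^-1` X) = (m1 \x m2)%E X.
Proof.
move=> mf1 mf2 h1 h2 F.
have mF : measurable_fun setT F.
  by apply: measurable_fun_pair; apply: measurableT_comp.
split=> // X mX.
apply/esym; apply: (@product_measure_unique _ _ _ _ _ m1 m2 (pushforward (m1 \x m2)%E F)) => //.
move=> A B mA mB; transitivity ((m1 \x m2)%E ((f1 @^-1` A) `*` (f2 @^-1` B))) => //.
have mA' : measurable (f1 @^-1` A) by rewrite -[X in measurable X]setTI; exact: mf1.
have mB' : measurable (f2 @^-1` B) by rewrite -[X in measurable X]setTI; exact: mf2.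
by rewrite product_measure1E//; congr (_ * _)%E; [exact: h1|exact: h2].
Qed.

Lemma leb4_translate (a : plane2 R) :
  measurable_fun [set: T4] (fun p : plane2 R => p + a : T4) /\
  forall X : set T4, measurable X ->
    @leb4 R ((fun p : plane2 R => p + a) @^-1` X) = @leb4 R X.
Proof.
have tr (b : R) : measurable_fun [set: mR] (fun x : R => x + b : mR).
  exact: measurable_funD.
have tr2 (b : R * R) := @product_measure_map _ _ mR mR (@lebesgue_measure R)
  (@lebesgue_measure R) _ _ (tr b.1) (tr b.2)
  (@lebesgue_measure_translate b.1) (@lebesgue_measure_translate b.2).
exact: (@product_measure_map _ _ _ _ (@leb2 R) (@leb2 R) _ _
  (tr2 a.1).1 (tr2 a.2).1 (tr2 a.1).2 (tr2 a.2).2).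
Qed.

Lemma integral_preserved d (T : measurableType d)
    (m : {measure set T -> \bar R}) (phi : T -> T) (f : T -> \bar R) :
  measurable_fun setT phi ->
  (forall A, measurable A -> m (phi @^-1` A) = m A) ->
  measurable_fun setT f -> m.-integrable setT (f \o phi) ->
  (\int[m]_x f (phi x) = \int[m]_x f x)%E.
Proof.
move=> mp hp mf If.
have E := integral_pushforward mp mf If measurableT.
transitivity (\int[pushforward m phi]_x f x)%E; first by rewrite E preimage_setT.
by apply: eq_measure_integral => A mA _; exact: hp.
Qed.

Lemma integral_translate (a : plane2 R) (f : plane2 R -> R) :
  (@leb4 R).-integrable setT (fun p : T4 => (f (p + a))%:E) ->
  measurable_fun setT (f : T4 -> R) ->
  (\int[@leb4 R]_p (f (p + a))%:E = \int[@leb4 R]_p (f p)%:E)%E.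
Proof.
move=> If mf; have [mt ht] := leb4_translate a.
have mf' : measurable_fun setT (fun p : T4 => (f p)%:E).
  exact/measurable_EFinP.
exact: (integral_preserved mt ht mf' If).
Qed.

End leb4_theory.

(** * Distributional Laplacians *)

Section second_difference.
Context {R : realType} {V : normedModType R}.

Lemma CkS_derive_line k (f : V -> R) (p v : V) (t : R) : Ck k.+1 f ->
  is_derive t 1 (fun s : R => f (s *: v + p)) ('D_v f (t *: v + p)).
Proof.
move=> Hf; have [fd fE] := CkS_derive v (t *: v + p) Hf.
have E : (fun h : R => h^-1 *: (((fun s : R => f (s *: v + p)) \o shift t) (h *: 1)
    - f (t *: v + p))) =
  (fun h : R => h^-1 *: ((f \o shift (t *: v + p)) (h *: v) - f (t *: v + p))).
  by apply/funext => h /=; rewrite [h%:A]mulr1 scalerDl addrA.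
by split; rewrite /derivable/derive E.
Qed.

(** Rolle's theorem, then the mean value theorem for the first derivative on a symmetric interval.
    An exact value at an intermediate point gives both the pointwise limit as [r] tends to 0 and a
    uniform bound. *)
Lemma second_difference (f : V -> R) (p v : V) (r : R) : Ck 2 f -> 0 < r ->
  exists2 c, `|c| < r & f (r *: v + p) + f (- r *: v + p) - 2 * f p =
    r ^+ 2 * 'D_v (fun y => 'D_v f y) (c *: v + p).
Proof.
move=> f2 r0.
have f1 : Ck 1 f by exact: CkW.
(* Chosen so that [G r = G 0], as Rolle's theorem requires. *)
pose k := (f (r *: v + p) + f (- r *: v + p) - 2 * f p) / r ^+ 2.
pose G (t : R) := f (t *: v + p) + f (- t *: v + p) - k * t ^+ 2.
pose dG (t : R) := 'D_v f (t *: v + p) - 'D_v f (- t *: v + p) - 2 * k * t.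
have GE (t : R) : is_derive t 1 G (dG t).
  have h1 := CkS_derive_line p v t f1.
  have h2 : is_derive t 1 (fun s : R => f (- s *: v + p)) ('D_v f (- t *: v + p) * (- 1)).
    by refine (@is_derive_comp _ _ (fun s => f (s *: v + p)) (fun s => - s) t 1 _ _ _ (CkS_derive_line p v (- t) f1)).
  have h3 : is_derive t 1 (fun s : R => k * s ^+ 2) (2 * k * t).
    apply: (is_derive_eq (is_deriveZ k (is_deriveX 2 (is_derive_id t 1)))).
    rewrite expr1 ![_ *: _]/(_ * _); change (k * (2 * t * 1) = 2 * k * t); ring.
  have := is_deriveB (is_deriveD h1 h2) h3; move/is_derive_eq; apply.
  by rewrite /dG mulrN1.
have [s /[!in_itv]/= /andP[s0 sr] dGs] : exists2 s, s \in `]0, r[ & dG s = 0.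
  have cG : {within `[0, r], continuous G}.
    by apply: derivable_within_continuous => x _; case: (GE x).
  have [||s sr [_ sE]] := @Rolle _ G 0 r r0 _ cG.
  - by move=> x _; case: (GE x).
  - rewrite /G !scale0r oppr0 scale0r add0r expr0n/= mulr0 subr0 /k.
    by rewrite mulfVK ?expf_neq0 ?gt_eqF//; ring.
  - by exists s => //; case: (GE s) => _ <-.
have [c /[!in_itv]/= /andP[c1 c2] cE] := @MVT R (fun t : R => 'D_v f (t *: v + p))
  (fun t : R => 'D_v (fun y => 'D_v f y) (t *: v + p)) (- s) s
  (gtrN s0)
  (fun x _ => CkS_derive_line p v x (CkS_Ck v f2))
  (derivable_within_continuous (fun x _ => ex_derive (is_derive := CkS_derive_line p v x (CkS_Ck v f2)))).
exists c.
  by rewrite ltr_norml (lt_trans _ c1) ?ltrN2//= (lt_trans c2).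
have kE : k = 'D_v (fun y => 'D_v f y) (c *: v + p).
  have s2 : s - - s = 2 * s by ring.
  move: dGs; rewrite /dG cE s2 -[2 * k * s]mulrA => /eqP.
  rewrite subr_eq0 mulrCA => /eqP/(mulfI _) h.
  by apply: (mulIf (_ : s != 0)); rewrite ?gt_eqF//; symmetry; apply: h.
by rewrite -kE /k [RHS]mulrC divfK// expf_neq0// gt_eqF.
Qed.

End second_difference.

(** * Integration by parts for second differences *)

Section nice.
Context {R : realType}.
Notation mR := (measurableTypeR R).
Notation T4 := ((mR * mR) * (mR * mR))%type.
Notation mu := (@leb4 R).
Implicit Types (f g u : plane2 R -> R).

(** A class of integrable functions stable under sums, translations and multiplication by bounded
    measurable functions, so that every integral below splits and shifts freely. *)
Definition bounded_support f := measurable_fun setT (f : T4 -> R) /\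
  exists (M B : R), forall p, `|f p| <= B /\ (~ box M p -> f p = 0).

Lemma bounded_support_integrable f : bounded_support f ->
  mu.-integrable setT (EFin \o (f : T4 -> R)).
Proof.
move=> [mf [M [B fB]]].
have Ib : mu.-integrable setT (EFin \o (B \o* \1_(box M : set T4))).
  rewrite (_ : _ \o _ = fun p => B%:E * (\1_(box M : set T4) p)%:E)%E; last first.
    by apply/funext => p /=; rewrite EFinM muleC.
  apply: integrableZl => //; apply/integrableP; split.
    by apply/measurable_EFinP; apply: measurable_indic; exact: measurable_box.
  under eq_integral do rewrite /= ger0_norm//.
  by rewrite integral_indic ?setIT; [exact: leb4_box| |exact: measurable_box].
apply: le_integrable Ib => //; first exact/measurable_EFinP.
move=> p _ /=; rewrite lee_fin; apply: le_trans (ler_norm _).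
rewrite indicE; have [fb f0] := fB p.
have [/set_mem ?|/negP pM] := boolP (p \in (box M : set T4)).
  by rewrite mul1r.
by rewrite mul0r f0 ?normr0// => pM'; apply: pM; exact/mem_set.
Qed.

Lemma bounded_supportM u f : measurable_fun setT (u : T4 -> R) ->
  (exists B, forall p, `|u p| <= B) -> bounded_support f ->
  bounded_support (fun p => u p * f p).
Proof.
move=> mfu [Bu uB] [mf [M [B fB]]]; split; first exact: measurable_funM.
exists M, (Bu * B) => p; have [h1 h2] := fB p; split.
  by rewrite normrM ler_pM.
by move=> /h2 ->; rewrite mulr0.
Qed.

Lemma box_le (M N : R) : M <= N -> box M `<=` box N.
Proof.
move=> MN [[x y] [z t]]; rewrite /box/= !in_itv/=.
move=> [[/andP[? ?] /andP[? ?]] [/andP[? ?] /andP[? ?]]].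
by do 2 split; apply/andP; split; lra.
Qed.

Lemma bounded_supportD f g : bounded_support f -> bounded_support g ->
  bounded_support (fun p => f p + g p).
Proof.
move=> [mf [M [B fB]]] [mg [N [C gC]]]; split; first exact: measurable_funD.
exists (Num.max M N), (B + C) => p; have [h1 h2] := fB p; have [h3 h4] := gC p.
split; first by rewrite (le_trans (ler_normD _ _))// lerD.
move=> pb; rewrite h2 ?h4 ?addr0// => hb; apply: pb; apply: box_le hb.
  by rewrite le_max lexx orbT.
by rewrite le_max lexx.
Qed.

Lemma box_translate (M : R) (p a : plane2 R) : box M (p + a) -> box (M + `|a|) p.
Proof.
case: p a => [[x y] [z t]] [[a b] [c d]].
have : `|((a, b), (c, d)) : plane2 R| <= `|((a, b), (c, d)) : plane2 R| by [].
rewrite {1}/Num.norm/= !ge_max => /andP[/andP[ha hb] /andP[hc hd]].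
move: ha hb hc hd; rewrite !ler_norml; set N := Num.norm _.
move=> /andP[? ?] /andP[? ?] /andP[? ?] /andP[? ?].
rewrite /box/= !in_itv/= => -[[/andP[? ?] /andP[? ?]] [/andP[? ?] /andP[? ?]]].
simpl in *.
by do 2 split; apply/andP; split; lra.
Qed.

Lemma bounded_support_translate f (a : plane2 R) : bounded_support f ->
  bounded_support (fun p => f (p + a)).
Proof.
move=> [mf [M [B fB]]]; split.
  exact: (measurableT_comp mf (leb4_translate a).1).
exists (M + `|a|), B => p; have [h1 h2] := fB (p + a); split => // pb.
by apply: h2; apply: contra_not pb; exact: box_translate.
Qed.

(** Discrete Laplacian on the complex line spanned by [v]: divided by [r ^+ 2] it tends to
    [laplacian v g p] when [g] is C^2, and it makes sense for any [g]. *)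
Definition diff2 (v : plane2 R) g (r : R) (p : plane2 R) : R :=
  g (p + r *: v) + g (p - r *: v) + g (p + r *: mulI2 v) + g (p - r *: mulI2 v)
  - 4 * g p.

Definition laplacian (v : plane2 R) g (p : plane2 R) : R :=
  'D_v (fun y => 'D_v g y) p +
  'D_(mulI2 v) (fun y => 'D_(mulI2 v) g y) p.

Lemma diff2_laplacian f p v (r : R) : Ck 2 f -> 0 < r ->
  exists c d, [/\ `|c| < r, `|d| < r & diff2 v f r p =
    r ^+ 2 * ('D_v (fun y => 'D_v f y) (c *: v + p) +
      'D_(mulI2 v) (fun y => 'D_(mulI2 v) f y) (d *: mulI2 v + p))].
Proof.
move=> f2 r0.
have [c c1 cE] := second_difference p v f2 r0.
have [d d1 dE] := second_difference p (mulI2 v) f2 r0.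
exists c, d; split => //.
have := congr2 +%R cE dE; rewrite -[X in _ = X]mulrDr => <-; rewrite /diff2.
rewrite !scaleNr ![_ + p]addrC.
move: (f (p + _)) (f (p - _)) (f (p + _)) (f (p - _)) (f p) => a1 a2 a3 a4 a5.
ring.
Qed.

Lemma Rintegral_translate f (a : plane2 R) : bounded_support f ->
  \int[mu]_p f (p + a) = \int[mu]_p f p.
Proof.
move=> bf; rewrite /Rintegral integral_translate//; last by case: bf.
exact: (bounded_support_integrable (bounded_support_translate a bf)).
Qed.

Lemma bounded_support_cst f (k : R) : bounded_support f ->
  bounded_support (fun p => k * f p).
Proof.
by apply: (bounded_supportM (u := fun=> k)) => //; exists `|k|.
Qed.

(** Self-adjointness of [diff2]: the shifts occur in opposite pairs, and moving a shift by [a] from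
    one factor to the other turns it into the shift by [- a]. *)
Lemma Rintegral_diff2 u f (v : plane2 R) (r : R) :
  measurable_fun setT (u : T4 -> R) ->
  (exists B, forall p, `|u p| <= B) -> bounded_support f ->
  bounded_support (fun p => u p * diff2 v f r p) /\
  bounded_support (fun p => diff2 v u r p * f p) /\
  \int[mu]_p (u p * diff2 v f r p) = \int[mu]_p (diff2 v u r p * f p).
Proof.
move=> mfu uB bf.
pose A (a : plane2 R) p := u p * f (p + a).
have bA a : bounded_support (A a).
  by apply: bounded_supportM => //; exact: bounded_support_translate.
pose B (a : plane2 R) p := u (p + a) * f p.
have bB a : bounded_support (B a).
  rewrite (_ : B a = fun p => A (- a) (p + a)); first exact: bounded_support_translate.
  by apply/funext => p; rewrite /A /B addrK.
have AB a : \int[mu]_p A a p = \int[mu]_p B (- a) p.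
  rewrite -(Rintegral_translate (- a) (bA a)); congr (fine (integral _ _ _)).
  by apply/funext => p; rewrite /A /B subrK.
have b4 := bounded_support_cst (- 4) (bA 0).
have E1 : (fun p => u p * diff2 v f r p) = (fun p => A (r *: v) p + A (- (r *: v)) p
    + A (r *: mulI2 v) p + A (- (r *: mulI2 v)) p + (-4) * A 0 p).
  by apply/funext => p; rewrite /A/diff2 addr0; ring.
have E2 : (fun p => diff2 v u r p * f p) = (fun p => B (- (r *: v)) p + B (r *: v) p
    + B (- (r *: mulI2 v)) p + B (r *: mulI2 v) p + (-4) * A 0 p).
  by apply/funext => p; rewrite /A/B/diff2 addr0; ring.
rewrite E1 E2; split; first by do ![exact: bA|exact: b4|apply: bounded_supportD].
split; first by do ![exact: bB|exact: b4|apply: bounded_supportD].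
rewrite !RintegralD//; try (apply: bounded_support_integrable; do ![exact: bA|exact: bB|exact: b4|apply: bounded_supportD]).
by rewrite !AB !opprK; congr (_ + _); rewrite -!addrA; congr (_ + _).
Qed.

Lemma continuous_bounded_support f (K : set (plane2 R)) : continuous f ->
  compact K -> (forall p, ~ K p -> f p = 0) -> bounded_support f.
Proof.
move=> cf cK fK; split; first exact: continuous_measurable4.
have [M KM] := compact_sub_box cK.
have /compact_bounded[B [_ fB]] : compact (f @` K).
  by apply: continuous_compact => //; exact: continuous_subspaceT.
exists M, (Num.max 0 (B + 1)) => p; split; last by move=> pM; apply: fK => /KM.
have [Kp|/fK ->] := pselect (K p); last by rewrite normr0 le_max lexx.
rewrite le_max; apply/orP; right; apply: (fB (B + 1)); first by rewrite ltrDl.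
by exists p.
Qed.

Lemma derive_off_compact f (K : set (plane2 R)) (v : plane2 R) : compact K ->
  (forall p, ~ K p -> f p = 0) -> forall p, ~ K p -> 'D_v f p = 0.
Proof.
move=> cK fK p Kp; rewrite -(derive_cst (0 : R) p v); apply: near_eq_derive.
have : open_nbhs p (~` K).
  split => //; apply: closed_openC; apply: compact_closed cK; exact: norm_hausdorff.
by move=> /open_nbhs_nbhs; apply: filterS => q; exact: fK.
Qed.

(* By translation invariance [u * diff2 chi] and [diff2 u * chi] have the same
   integral; divide by [r ^+ 2] and let [r] tend to 0. *)
Lemma diff2_limit_ge0 u chi D1 D2 (K : set (plane2 R)) (v : plane2 R) (C r0 : R) :
  measurable_fun setT (u : T4 -> R) -> (exists B, forall p, `|u p| <= B) ->
  compact K -> (forall p, ~ K p -> chi p = 0) ->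
  (forall p, ~ K p -> D1 p = 0) -> (forall p, ~ K p -> D2 p = 0) ->
  continuous chi -> continuous D1 -> continuous D2 ->
  (forall p r, 0 < r -> exists c d, [/\ `|c| < r, `|d| < r & diff2 v chi r p =
    r ^+ 2 * (D1 (c *: v + p) + D2 (d *: mulI2 v + p))]) ->
  0 < r0 ->
  (forall r p, 0 < r -> r < r0 -> - (C * r ^+ 4) <= diff2 v u r p * chi p) ->
  bounded_support (fun p => u p * (D1 p + D2 p)) /\
  0 <= \int[mu]_p (u p * (D1 p + D2 p)).
Proof.
move=> mfu [Bu uB] cK chiK D1K D2K cchi cD1 cD2 diff2E r00 Hr.
have bchi := continuous_bounded_support cchi cK chiK.
have bD1 := continuous_bounded_support cD1 cK D1K.
have bD2 := continuous_bounded_support cD2 cK D2K.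
have [M KM] := compact_sub_box cK.
have uB' : exists B, forall p, `|u p| <= B by exists Bu.
have bL : bounded_support (fun p => u p * (D1 p + D2 p)).
  by apply: bounded_supportM => //; exact: bounded_supportD.
split => //.
(* Below [r0], so that the hypothesis on [diff2 v u] applies, and below 1, so that the shifted
   supports stay in one fixed box. *)
pose r1 := Num.min r0 1 / 2.
have r10 : 0 < r1 by rewrite divr_gt0// lt_min r00/=.
have r1r0 : r1 < r0.
  by rewrite /r1 ltr_pdivrMr// gt_min; apply/orP; left; rewrite ltr_pMr// ltr1n.
have r11 : r1 < 1.
  by rewrite /r1 ltr_pdivrMr// gt_min mul1r ltr1n orbT.
pose r (n : nat) := r1 * n.+1%:R^-1.
have rn0 n : 0 < r n by rewrite mulr_gt0// invr_gt0.
have rn1 n : r n <= r1 by rewrite ger_pMr// invf_le1// ler1n.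
have cr : r @ \oo --> (0 : R).
  rewrite -(mulr0 r1); apply: cvgMr; exact: cvg_harmonic.
pose g n p := (r n) ^- 2 * (u p * diff2 v chi (r n) p).
have gE n := Rintegral_diff2 v (r n) mfu uB' bchi.
have bg n : bounded_support (g n) by apply: bounded_support_cst; exact: (gE n).1.
have gD n p : exists c d, [/\ `|c| < r n, `|d| < r n & g n p =
    u p * (D1 (c *: v + p) +
      D2 (d *: mulI2 v + p))].
  have [c [d [c1 d1 E]]] := diff2E p _ (rn0 n).
  exists c, d; split => //; rewrite /g E.
  by rewrite [u p * _]mulrCA mulKf// expf_neq0// gt_eqF.
have cvg_g p : g ^~ p @ \oo --> u p * (D1 p + D2 p).
  have [c cP] := choice (fun n => gD n p).
  have [d dP] := choice cP.
  have -> : g ^~ p = fun n => u p * (D1 (c n *: v + p) +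
      D2 (d n *: mulI2 v + p)).
    by apply/funext => n; case: (dP n).
  have c0 (a : nat -> R) (w : plane2 R) (G : plane2 R -> R) : continuous G ->
      (forall n, `|a n| < r n) -> G (a n *: w + p) @[n --> \oo] --> G p.
    move=> cG ar; have h : a n *: w + p @[n --> \oo] --> 0 *: w + p; last first.
      by rewrite scale0r add0r in h; exact: cvg_comp h (cG p).
    apply: cvgD; last exact: cvg_cst.
    apply: cvgZr_tmp; apply/norm_cvg0P.
    apply: (squeeze_cvgr _ (cvg_cst 0) cr); near=> n.
    by rewrite normr_ge0/= ltW.
  apply: cvgMr; apply: cvgD.
    apply: (c0 c v D1).
      exact: cD1.
    by move=> n; case: (dP n).
  apply: (c0 d (mulI2 v) D2).
    exact: cD2.
  by move=> n; case: (dP n).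
have [mD1 [M1 [B1 B1P]]] := bD1; have [mD2 [M2 [B2 B2P]]] := bD2.
(* A point within one step of [K] in the directions [v] and [mulI2 v] lies in [box N]; this supports
   the dominating function. *)
pose N := M + Num.max `|v| `|mulI2 v|.
pose dom (p : T4) : R := (Bu * (B1 + B2)) * \1_(box N : set T4) p.
have Bu0 : 0 <= Bu by apply: le_trans (uB 0).
have B10 : 0 <= B1 by apply: le_trans (B1P 0).1.
have B20 : 0 <= B2 by apply: le_trans (B2P 0).1.
have bind (m : R) : bounded_support (\1_(box m : set T4) : T4 -> R).
  split; first by apply: measurable_indic; exact: measurable_box.
  exists m, 1 => p; rewrite indicE; split; first by case: (_ \in _); rewrite ?normr0 ?normr1.
  by move=> pm; rewrite memNset.
have bdom : bounded_support dom by apply: bounded_support_cst; exact: bind.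
have g_dom n p : `|g n p| <= dom p.
  have [c [d [c1 d1 ->]]] := gD n p.
  rewrite /dom indicE; have [_|/negP pN] := boolP (p \in (box N : set T4)).
    rewrite mulr1 normrM ler_pM// (le_trans (ler_normD _ _))// lerD//.
      by case: (B1P (c *: v + p)).
    by case: (B2P (d *: mulI2 v + p)).
  have off (a : R) (w : plane2 R) : `|a| < r n -> `|w| <= Num.max `|v| `|mulI2 v| ->
      ~ K (a *: w + p).
    move=> ar wv /KM; rewrite addrC => /box_translate pM; apply: pN.
    apply/mem_set; apply: box_le pM; rewrite lerD2l normrZ (le_trans _ wv)//.
    by rewrite ler_piMl// ltW// (lt_trans ar)// (le_lt_trans (rn1 n)).
  rewrite D1K ?D2K ?addr0 ?mulr0 ?normr0 ?mulr0//; apply: off => //.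
    by rewrite le_max lexx orbT.
  by rewrite le_max lexx.
have mE f : bounded_support f -> measurable_fun setT (fun p : T4 => (f p)%:E).
  by move=> [mf _]; exact/measurable_EFinP.
have ecvg p : (g n p)%:E @[n --> \oo] --> (u p * (D1 p + D2 p))%:E.
  by apply: cvg_EFin; [exact: nearW|exact: cvg_g].
have [|||||_ _ lim] := @dominated_convergence _ T4 R mu setT measurableT
  (fun n p => (g n p)%:E) (fun p => (u p * (D1 p + D2 p))%:E) (fun p => (dom p)%:E).
- by move=> n; exact: mE.
- exact: mE.
- by apply: aeW => p _; exact: ecvg.
- exact: bounded_support_integrable.
- by apply: aeW => p n _ /=; rewrite lee_fin; exact: g_dom.
have lim' : (fun n => \int[mu]_p g n p) @ \oo --> \int[mu]_p (u p * (D1 p + D2 p)).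
  apply: fine_cvg; move: lim; rewrite /Rintegral fineK//.
  exact: integrable_fin_num (bounded_support_integrable bL).
pose c0 := \int[mu]_p (\1_(box M : set T4) p : R).
have c00 : 0 <= c0 by apply: Rintegral_ge0 => p _; rewrite indicE.
(* The error is of order [r ^+ 4] on the bounded set [box M], and the normalisation divides by
   [r ^+ 2] only, so it disappears in the limit. *)
have lb n : - (`|C| * c0) * r n ^+ 2 <= \int[mu]_p g n p.
  rewrite RintegralZl//; last exact: bounded_support_integrable (gE n).1.
  rewrite (gE n).2.2 ler_pdivlMl ?exprn_gt0//.
  have -> : r n ^+ 2 * (- (`|C| * c0) * r n ^+ 2) = - (`|C| * r n ^+ 4) * c0 by ring.
  rewrite -RintegralZl//; last exact: bounded_support_integrable.
  apply: le_Rintegral => //.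
  - exact: bounded_support_integrable (bounded_support_cst _ (bind M)).
  - exact: bounded_support_integrable (gE n).2.1.
  move=> p _; rewrite indicE; have [_|/negP pM] := boolP (p \in (box M : set T4)).
    rewrite mulr1; apply: le_trans (Hr _ p (rn0 n) (le_lt_trans (rn1 n) r1r0)).
    by rewrite lerN2 ler_wpM2r ?ler_norm// exprn_ge0// ltW.
  by rewrite chiK ?mulr0// => /KM /mem_set.
have l0 : - (`|C| * c0) * r n ^+ 2 @[n --> \oo] --> (0 : R).
  have h : - (`|C| * c0) * (r n * r n) @[n --> \oo] --> - (`|C| * c0) * (0 * 0).
    by apply: cvgMr; exact: cvgM.
  by rewrite !mulr0 in h.
apply: (ler_cvg_to l0 lim'); exact: nearW.
Unshelve. all: by end_near. Qed.

(** The fourth-order error admits functions such as log (e + |w|^2), for which the estimate obtained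
    later bounds the second differences below only up to O([r ^+ 4]). *)
Lemma weak_laplacian_ge0 u chi (K : set (plane2 R)) (v : plane2 R) (C r0 : R) :
  measurable_fun setT (u : T4 -> R) -> (exists B, forall p, `|u p| <= B) ->
  Ck 2 chi -> compact K -> (forall p, ~ K p -> chi p = 0) -> 0 < r0 ->
  (forall r p, 0 < r -> r < r0 -> - (C * r ^+ 4) <= diff2 v u r p * chi p) ->
  bounded_support (fun p => u p * laplacian v chi p) /\
  0 <= \int[mu]_p (u p * laplacian v chi p).
Proof.
move=> mfu uB chi2 cK chiK r00 Hr.
have off w p : ~ K p -> 'D_w (fun y => 'D_w chi y) p = 0.
  by apply: derive_off_compact => // q; exact: derive_off_compact.
apply: (diff2_limit_ge0 (D1 := fun p => 'D_v (fun y => 'D_v chi y) p)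
  (D2 := fun p => 'D_(mulI2 v) (fun y => 'D_(mulI2 v) chi y) p)
  mfu uB cK chiK (off v) (off (mulI2 v)) (Ck_continuous chi2) _ _ _ r00 Hr).
- exact: (Ck_continuous (CkS_Ck v (CkS_Ck v chi2))).
- exact: (Ck_continuous (CkS_Ck _ (CkS_Ck _ chi2))).
- by move=> p r; exact: diff2_laplacian.
Qed.

End nice.

(** * Circular means of log (e + |w|^2) *)

Section circle_mean.
Context {R : realType}.
Notation mu := (@lebesgue_measure R).
Implicit Types (G : R -> R) (a b al be t A : R).

Lemma continuous_itv_integrable G a b : continuous G ->
  mu.-integrable `[a, b] (EFin \o G).
Proof.
move=> cG; apply: continuous_compact_integrable; first exact: segment_compact.
exact: continuous_subspaceT.
Qed.

Lemma Rintegral_affine G (c d : R) a b : 0 < c -> a <= b -> continuous G ->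
  \int[mu]_(x in `[c * a + d, c * b + d]) G x =
  c * \int[mu]_(x in `[a, b]) G (c * x + d).
Proof.
move=> c0 ab cG; pose F (x : R) := c * x + d.
have dF (x : R) : is_derive x 1 F c.
  apply: (is_derive_eq (is_deriveD (is_deriveZ c (is_derive_id x 1)) (is_derive_cst d x 1))).
  by rewrite addr0 [_ *: _]mulr1.
have F'E : F^`()%classic = cst c.
  by apply/funext => x; rewrite derive1E; case: (dF x).
have cF : continuous F.
  by move=> x; apply/differentiable_continuous/derivable1_diffP; case: (dF x).
have H := @integration_by_substitution_increasing R F G a b ab.
rewrite /Rintegral -/(F a) -/(F b) H.
- transitivity (\int[mu]_(x in `[a, b]) (c * G (F x))).
    congr fine; apply: eq_integral => x _; rewrite F'E /= mulrC//.
  rewrite RintegralZl//.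
  apply: continuous_itv_integrable => x; apply: continuous_comp; [exact: cF|exact: cG].
- by move=> x y _ _ xy; rewrite /F ltrD2r ltr_pM2l.
- by rewrite F'E => x _; exact: cst_continuous.
- by rewrite F'E; exact: is_cvg_cst.
- by rewrite F'E; exact: is_cvg_cst.
- split; first by move=> x _; case: (dF x).
    by apply: cvg_at_right_filter; exact: cF.
  by apply: cvg_at_left_filter; exact: cF.
- exact: continuous_subspaceT.
Qed.

(** Antipodal pairing: the terms in [cos t] and [sin t] of [trig] change sign under a shift by
    [pi]. *)
Lemma Rintegral_half_circle G : continuous G ->
  \int[mu]_(x in `[0, 2 * pi]) G x =
  \int[mu]_(x in `[0, pi]) (G x + G (x + pi)).
Proof.
move=> cG; have pi0 := @pi_gt0 R.
have cG' : continuous (fun x => G (x + pi)).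
  move=> x; apply: continuous_comp; last exact: cG.
  by apply: continuousD; [exact: cvg_id|exact: cst_continuous].
rewrite RintegralD//; try exact: continuous_itv_integrable.
have := @Rintegral_itvB R G (BLeft 0) (BRight (2 * pi)) pi
  (continuous_itv_integrable _ _ cG).
rewrite !bnd_simp (ltW pi0) => /(_ isT).
have -> : pi <= 2 * pi :> R by rewrite ler_pMl// ler1n.
move=> /(_ isT)/(canRL (subrK _)) ->; rewrite addrC; congr (_ + _).
rewrite Rintegral_itv_obnd_cbnd; last first.
  apply: integrableS (continuous_itv_integrable pi (2 * pi) cG) => //.
  by apply: subset_itvr; rewrite bnd_simp.
have := @Rintegral_affine G 1 pi 0 pi ltr01 (ltW pi0) cG.
rewrite mulr0 add0r !mul1r => E.
transitivity (\int[mu]_(x in `[pi, pi + pi]) G x).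
  by rewrite mulr_natl mulr2n.
by rewrite E; apply: eq_Rintegral => x _; rewrite mul1r.
Qed.

(** For [A = a + b] and [al ^+ 2 + be ^+ 2 = 4 * a * b] this is |sqrt a + sqrt b e^(it)|^2 up to a
    shift of [t]. If [b < a], the function sqrt a + sqrt b zeta has no zero in the closed disc, so
    the circular mean of the logarithm is ln a. *)
Definition trig (A al be t : R) := A + al * cos t + be * sin t.

Lemma continuous_trig A al be : continuous (trig A al be).
Proof.
move=> x; apply: (@continuousD _ _ _ (fun t => A + al * cos t) (fun t => be * sin t)).
  apply: continuousD; first exact: cst_continuous.
  by apply: continuousM; [exact: cst_continuous|exact: continuous_cos].
by apply: continuousM; [exact: cst_continuous|exact: continuous_sin].
Qed.

Lemma trig_sqr_le al be t : (al * cos t + be * sin t) ^+ 2 <= al ^+ 2 + be ^+ 2.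
Proof.
have cs := cos2Dsin2 t; rewrite -subr_ge0.
have -> : al ^+ 2 + be ^+ 2 = (al ^+ 2 + be ^+ 2) * (cos t ^+ 2 + sin t ^+ 2).
  by rewrite cs mulr1.
rewrite (_ : _ - _ = (al * sin t - be * cos t) ^+ 2); last by ring.
exact: sqr_ge0.
Qed.

Lemma trig_gt0 a b al be t : 0 <= b -> b < a -> al ^+ 2 + be ^+ 2 = 4 * a * b ->
  0 < trig (a + b) al be t.
Proof.
move=> b0 ba E; have H := trig_sqr_le al be t; rewrite E in H.
rewrite /trig -addrA; set X := _ * _ + _ in H *.
have h : `|X| < a + b.
  have : X ^+ 2 < (a + b) ^+ 2.
    apply: le_lt_trans H _; rewrite -subr_gt0 (_ : _ - _ = (a - b) ^+ 2); last by ring.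
    by rewrite exprn_gt0// subr_gt0.
  have ab0 : 0 <= a + b by lra.
  by rewrite -(@ltr_pXn2r _ 2 isT `|X|) ?nnegrE// real_normK ?num_real.
move: h; rewrite ltr_norml => /andP[? _]; lra.
Qed.

Lemma continuous_ln_trig a b al be : 0 <= b -> b < a ->
  al ^+ 2 + be ^+ 2 = 4 * a * b -> continuous (fun t => ln (trig (a + b) al be t)).
Proof.
move=> b0 ba E t; apply: (continuous_comp (f := trig (a + b) al be) (g := @ln R)).
  exact: continuous_trig.
by apply: continuous_ln; exact: trig_gt0.
Qed.

(* Multiplying the values at [t] and [t + pi] turns the trigonometric polynomial
   [a + b + ...] at [t] into one of the form [a^2 + b^2 + ...] at [2 t]. *)
Lemma Rintegral_ln_trig_double a b al be : 0 <= b -> b < a ->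
  al ^+ 2 + be ^+ 2 = 4 * a * b ->
  let al' := - (al ^+ 2 - be ^+ 2) / 2 in let be' := - (al * be) in
  al' ^+ 2 + be' ^+ 2 = 4 * a ^+ 2 * b ^+ 2 /\
  \int[mu]_(t in `[0, 2 * pi]) ln (trig (a + b) al be t) =
  2^-1 * \int[mu]_(t in `[0, 2 * pi]) ln (trig (a ^+ 2 + b ^+ 2) al' be' t).
Proof.
move=> b0 ba E al' be'.
have E' : al' ^+ 2 + be' ^+ 2 = 4 * a ^+ 2 * b ^+ 2.
  rewrite (_ : _ + _ = (al ^+ 2 + be ^+ 2) ^+ 2 / 4); last by rewrite /al' /be'; field.
  by rewrite E; field.
split => //.
rewrite Rintegral_half_circle; last exact: continuous_ln_trig.
have b20 : 0 <= b ^+ 2 by exact: sqr_ge0.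
have ba2 : b ^+ 2 < a ^+ 2 by rewrite ltr_pXn2r// ?nnegrE//; lra.
have := @Rintegral_affine (fun t => ln (trig (a ^+ 2 + b ^+ 2) al' be' t)) 2 0 0 pi
  (ltr0n _ 2) (ltW (pi_gt0 _)) (continuous_ln_trig b20 ba2 E').
rewrite !addr0 mulr0 => ->; rewrite mulrA mulVf// mul1r.
apply: eq_Rintegral => t _; rewrite addr0 -lnM ?posrE ?trig_gt0//; congr ln.
rewrite [2 * t]mulr_natl /trig cosDpi sinDpi cos_mulr2n sin_mulr2n.
have cs := cos2Dsin2 t; set c := cos t in cs *; set s := sin t in cs *.
rewrite /al' /be'.
have -> : a ^+ 2 + b ^+ 2 = (a + b) ^+ 2 - (al ^+ 2 + be ^+ 2) / 2 by rewrite E; field.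
have -> : c ^+ 2 *+ 2 - 1 = c ^+ 2 - s ^+ 2 by rewrite -cs; ring.
have -> : (al ^+ 2 + be ^+ 2) / 2 = (al ^+ 2 + be ^+ 2) / 2 * (c ^+ 2 + s ^+ 2).
  by rewrite cs mulr1.
by field.
Qed.

(** Each doubling squares [a] and [b] and halves the error. After [n] of them the crude bound
    applies: 16 b <= a makes the amplitude 2 sqrt(ab) at most a/2, so [trig] is at least a/2 and the
    loss is ln 2 in the mean. *)
Lemma Rintegral_ln_trig_lb n a b al be : 0 <= b -> b < a ->
  al ^+ 2 + be ^+ 2 = 4 * a * b -> 16 * b ^+ (2 ^ n) <= a ^+ (2 ^ n) ->
  2 * pi * ln a - 2 * pi * ln 2 / 2 ^+ n <=
  \int[mu]_(t in `[0, 2 * pi]) ln (trig (a + b) al be t).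
Proof.
elim: n a b al be => [|n ih] a b al be b0 ba E.
  rewrite expn0 !expr1 expr0 divr1 => ab16.
  have a0 : 0 < a by lra.
  have -> : 2 * pi * ln a - 2 * pi * ln 2 = \int[mu]_(t in `[0, 2 * pi]) (ln (a / 2)).
    rewrite Rintegral_cst// (_ : fine _ = 2 * pi) ?ln_div ?posrE//; first by ring.
    have mE := @lebesgue_measure_itv R `[0, 2 * pi].
    rewrite /= lte_fin mulr_gt0 ?pi_gt0// in mE.
    by transitivity (fine ((2 * pi : R) - 0)%:E); [congr fine; exact: mE|rewrite subr0].
  apply: le_Rintegral => //.
  - by apply: continuous_itv_integrable => x; exact: cst_continuous.
  - by apply: continuous_itv_integrable; exact: continuous_ln_trig.
  move=> t _; rewrite ler_ln ?posrE ?trig_gt0 ?divr_gt0//.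
  have H := trig_sqr_le al be t; rewrite E in H.
  rewrite /trig -addrA; set X := _ * _ + _ in H *.
  have h : `|X| <= a / 2.
    have : X ^+ 2 <= (a / 2) ^+ 2 by apply: le_trans H _; nra.
    have a20 : 0 <= a / 2 by lra.
    by rewrite -(@ler_pXn2r _ 2 isT `|X|) ?nnegrE// real_normK ?num_real.
  move: h; rewrite ler_norml => /andP[? _]; lra.
move=> H; have [E' ->] := Rintegral_ln_trig_double b0 ba E.
have b20 : 0 <= b ^+ 2 by exact: sqr_ge0.
have ba2 : b ^+ 2 < a ^+ 2 by rewrite ltr_pXn2r// ?nnegrE//; lra.
have := ih _ _ _ _ b20 ba2 E'; rewrite -!exprM -expnS => /(_ H) {}ih.
rewrite [leRHS]mulrC ler_pdivlMr//; apply: le_trans ih.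
rewrite lnXn; last lra.
by rewrite exprS invfM -[ln a *+ 2]mulr_natr; rewrite le_eqVlt; apply/orP; left; apply/eqP; field; rewrite expf_neq0.
Qed.

Lemma Rintegral_ln_trig a b al be : 0 <= b -> b < a ->
  al ^+ 2 + be ^+ 2 = 4 * a * b ->
  2 * pi * ln a <= \int[mu]_(t in `[0, 2 * pi]) ln (trig (a + b) al be t).
Proof.
move=> b0 ba E; have a0 : 0 < a by lra.
set I := Rintegral _ _ _.
have c2 : 2 * pi * ln a - 2 * pi * ln 2 * geometric 1 (2^-1) n @[n --> \oo] -->
    2 * pi * ln a - 2 * pi * ln 2 * 0.
  apply: cvgB; first exact: cvg_cst.
  apply: cvgMr; apply: cvg_geometric.
  by rewrite gtr0_norm ?invr_gt0// invf_lt1// ltr1n.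
have c1 : geometric 16 (b / a) n @[n --> \oo] --> (0 : R).
  by apply: cvg_geometric; rewrite ger0_norm ?divr_ge0 ?(ltW a0)// ltr_pdivrMr// mul1r.
have hn : \forall n \near \oo, geometric 16 (b / a) n <= 1.
  by apply: cvgr_le; [exact: c1|exact: ltr01].
rewrite mulr0 subr0 in c2; apply: (ler_cvg_to c2 (cvg_cst I)).
near=> n; rewrite /geometric/= mul1r exprVn; apply: Rintegral_ln_trig_lb => //.
have h : 16 * (b / a) ^+ n <= 1.
  by near: n; exact: hn.
have : 16 * (b / a) ^+ (2 ^ n) <= 1.
  apply: le_trans h; rewrite ler_wpM2l// ler_wiXn2l ?divr_ge0 ?(ltW a0)//.
    by rewrite ltW// ltr_pdivrMr// mul1r.
  exact/ltnW/ltn_expl.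
by rewrite expr_div_n mulrA ler_pdivrMr ?exprn_gt0// mul1r.
Unshelve. all: by end_near. Qed.

Lemma sqmod_line (x v : plane R) t :
  sqmod (x + (cos t *: v + sin t *: mulI v)) =
  trig (sqmod x + sqmod v) (2 * (x.1 * v.1 + x.2 * v.2))
    (2 * (x.2 * v.1 - x.1 * v.2)) t.
Proof.
have sE (a b : R) : a *: b = a * b by [].
rewrite /sqmod /trig /mulI/= !sE.
have cs := cos2Dsin2 t.
have -> : v.1 ^+ 2 + v.2 ^+ 2 = (v.1 ^+ 2 + v.2 ^+ 2) * (cos t ^+ 2 + sin t ^+ 2).
  by rewrite cs mulr1.
ring.
Qed.

(** With X = |x|^2 and V = |v|^2, let [a] and [b] be the roots of T^2 - (e + X + V) T + XV. The
    discriminant is (e + X - V)^2 + 4eV, so the larger root [a] is at least e + X; the mean, at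
    least ln a, is thus at least ln (e + X). *)
Lemma ln_sqmod_mean (e : R) (x v : plane R) : 0 < e ->
  2 * pi * ln (e + sqmod x) <=
  \int[mu]_(t in `[0, 2 * pi]) ln (e + sqmod (x + (cos t *: v + sin t *: mulI v)))
  /\ continuous (fun t => ln (e + sqmod (x + (cos t *: v + sin t *: mulI v)))).
Proof.
move=> e0.
pose X := sqmod x; pose V := sqmod v.
have X0 : 0 <= X by rewrite addr_ge0// sqr_ge0.
have V0 : 0 <= V by rewrite addr_ge0// sqr_ge0.
set al := 2 * (x.1 * v.1 + x.2 * v.2); set be := 2 * (x.2 * v.1 - x.1 * v.2).
have XV : al ^+ 2 + be ^+ 2 = 4 * X * V by rewrite /al/be/X/V/sqmod; ring.
pose A := e + X + V; pose D := A ^+ 2 - 4 * X * V; pose d := Num.sqrt D.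
have DE : D = (e + X - V) ^+ 2 + 4 * e * V by rewrite /D/A; ring.
have D0 : 0 < D.
  have [V00|V00|V00] := ltrgtP V 0; first lra.
    by rewrite DE ltr_wpDl ?sqr_ge0// !mulr_gt0.
  by rewrite DE V00 mulr0 addr0 subr0 exprn_gt0//; lra.
have d2 : d ^+ 2 = D by rewrite sqr_sqrtr// ltW.
have d0 : 0 < d by rewrite sqrtr_gt0.
pose a := (A + d) / 2; pose b := (A - d) / 2.
have ab : a + b = A by rewrite /a/b; field.
have eab : al ^+ 2 + be ^+ 2 = 4 * a * b.
  have -> : 4 * a * b = A ^+ 2 - d ^+ 2 by rewrite /a/b; field.
  by rewrite XV d2 /D; ring.
have b0 : 0 <= b.
  rewrite /b divr_ge0// subr_ge0 -ler_sqr ?nnegrE ?(ltW d0)//; last by rewrite /A; lra.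
  by rewrite d2 /D lerBlDr lerDl; nra.
have ba : b < a by rewrite /a /b; lra.
have E t : e + sqmod (x + (cos t *: v + sin t *: mulI v)) = trig (a + b) al be t.
  by rewrite sqmod_line ab /A/trig -/X -/V -/al -/be; ring.
under eq_Rintegral do rewrite E.
split; last by under eq_fun do rewrite E; exact: continuous_ln_trig.
apply: le_trans (Rintegral_ln_trig b0 ba eab).
have eX : 0 < e + sqmod x by rewrite -/X; lra.
have a0 : 0 < a by lra.
rewrite ler_pM2l ?mulr_gt0 ?pi_gt0// ler_ln ?posrE//.
have : e + X - V <= d.
  have [h|h] := leP (e + X - V) 0; first exact: le_trans h (ltW d0).
  have : (e + X - V) ^+ 2 <= d ^+ 2.
    by rewrite d2 DE lerDl; apply: mulr_ge0 => //; apply: mulr_ge0 => //; exact: ltW.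
  by rewrite ler_pXn2r// ?nnegrE; exact: ltW.
by rewrite -/X /a /A => ?; lra.
Qed.

End circle_mean.

(** * The maximum principle *)

(* No measurability is assumed: the library's integral is a supremum over simple
   functions, hence monotone on arbitrary functions. *)
Lemma integral_le_nomeas d (T : measurableType d) (R : realType)
    (mu : {measure set T -> \bar R}) (D : set T) (f g : T -> \bar R) :
  (forall x, D x -> f x <= g x)%E ->
  (\int[mu]_(x in D) f x <= \int[mu]_(x in D) g x)%E.
Proof.
move=> fg.
have fgD x : ((f \_ D) x <= (g \_ D) x)%E.
  by rewrite /patch; case: ifPn => // /set_mem; exact: fg.
rewrite /integral; apply: leeB; apply: le_ereal_sup => _ [h /= hle <-];
  exists h => //= x; apply: le_trans (hle x) _.
  by rewrite !funeposE; exact: le_max2.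
by rewrite !funenegE; apply: le_max2 => //; rewrite leeN2.
Qed.

Lemma usc_onD (T : topologicalType) (R : realType) (A : set T)
    (g : T -> \bar R) (h : T -> R) : usc_on A g ->
  (forall x, A x -> (g x < +oo)%E) -> continuous h ->
  usc_on A (fun x => (g x + (h x)%:E)%E).
Proof.
move=> ug goo ch x Ax a fa.
have ga : (g x < (a - h x)%:E)%E by rewrite EFinB lteBrDr.
have [b [gb ba]] : exists b : R, (g x < b%:E)%E /\ b < a - h x.
  case: (g x) ga (goo x Ax) => [y|//|_ _].
    by rewrite lte_fin => ya _; exists ((y + (a - h x)) / 2); rewrite lte_fin; split; lra.
  by exists (a - h x - 1); rewrite ltNyr; split => //; lra.
have h1 : \forall w \near x, h w < a - b.
  have sab : h x < a - b by lra.
  exact: (@cvgr_lt _ _ _ _ h _ (ch x) _ sab).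
have h2 := ug x Ax b gb; rewrite near_withinE in h2; rewrite near_withinE.
move: h1 h2; apply: filterS2.
move=> w /= sw gw /gw {}gw.
have : ((h w)%:E < (a - b)%:E)%E by rewrite lte_fin.
move=> /(lteD gw); by rewrite -EFinD addrCA subrr addr0.
Qed.

Lemma seq_max_ereal (T : eqType) (R : realType) (f : T -> \bar R) (s : seq T) x :
  x \in s -> exists2 i, i \in s & forall j, j \in s -> (f j <= f i)%E.
Proof.
elim: s x => // a [|b s] ih x _.
  by exists a; rewrite ?mem_head// => j; rewrite inE => /eqP ->.
have [i si fi] := ih b (mem_head _ _).
have [fai|/ltW fia] := leP (f a) (f i).
  exists i; first by rewrite inE si orbT.
  by move=> j; rewrite inE => /predU1P[->//|]; exact: fi.
exists a; first exact: mem_head.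
by move=> j; rewrite inE => /predU1P[->//|/fi]; move/le_trans; apply.
Qed.

(** If there were no maximum, the relatively open sets {f < f y} would cover [A]. Among the finitely
    many [y] of a subcover, one with the largest [f y] lies in none of the sets. *)
Lemma usc_on_max (R : realType) (T : normedModType R) (A : set T)
    (f : T -> \bar R) : compact A -> A !=set0 -> usc_on A f ->
  (forall x, A x -> f x < +oo)%E ->
  exists2 x0, A x0 & forall x, A x -> (f x <= f x0)%E.
Proof.
move=> cA [a Aa] uf foo; apply: contrapT => nmax.
have {}cA : cover_compact A by rewrite -compact_cover.
have ex x : A x -> exists2 y, A y & (f x < f y)%E.
  move=> Ax; apply: contrapT => ny; apply: nmax; exists x => // y Ay.
  by rewrite leNgt; apply/negP => fxy; apply: ny; exists y.
pose U y := [set z | A z -> (f z < f y)%E]^°.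
have [|x Ax|D' D'A AD'] := cA T A U.
- by move=> y _; exact: open_interior.
- have [y Ay fxy] := ex _ Ax; exists y => //.
  have yE : f y = (fine (f y))%:E.
    by rewrite fineK// fin_numElt foo// (le_lt_trans (leNye _) fxy).
  have := uf x Ax (fine (f y)); rewrite -yE => /(_ fxy).
  by rewrite /U /interior/= near_withinE.
have [i0 iD' _] := AD' a Aa.
have [i iD imax] := @seq_max_ereal T R f (finmap.enum_fset D') i0 iD'.
have Ai : A i by have := D'A i iD; rewrite inE.
have [j jD /interior_subset/(_ Ai)] := AD' i Ai.
by rewrite ltNge imax.
Qed.

(** * A maximum principle for semicontinuous functions on the disc *)

Section disc_maximum_principle.
Context {R : realType}.
Notation mu := (@lebesgue_measure R).
Implicit Types (z w : plane R).

Lemma sqmod_ge0 z : 0 <= sqmod z.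
Proof. by rewrite addr_ge0// sqr_ge0. Qed.

Lemma continuous_sqmod : continuous (@sqmod R).
Proof.
move=> z; apply: (@continuousD _ _ _ (fun z : plane R => z.1 * z.1) (fun z => z.2 * z.2)).
  by apply: continuousM; exact: cvg_fst.
by apply: continuousM; exact: cvg_snd.
Qed.

Lemma compact_sqmod_le (M : R) : compact [set z : plane R | sqmod z <= M].
Proof.
apply: (@subclosed_compact _ _ (`[- (M + 1), M + 1]%classic `*` `[- (M + 1), M + 1]%classic)).
- rewrite (_ : [set z : plane R | _] = @sqmod R @^-1` [set t | t <= M])//.
  by apply: preimage_closed; [move=> z _; exact: continuous_sqmod|exact: closed_le].
- by apply: compact_setX; exact: segment_compact.
move=> z /= zM; have M0 : 0 <= M := le_trans (sqmod_ge0 z) zM.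
have M1 : M <= (M + 1) ^+ 2 by have := sqr_ge0 M; lra.
have le (x : R) : x ^+ 2 <= M -> x \in `[- (M + 1), M + 1].
  move=> xM; rewrite in_itv/= -ler_norml -(@ler_pXn2r _ 2 isT) ?nnegrE ?addr_ge0//.
  by rewrite real_normK ?num_real// (le_trans xM).
by split; apply: le; apply: le_trans zM; rewrite ?lerDl ?lerDr sqr_ge0.
Qed.

Lemma sqmod_add_le z w (a b : R) : 0 <= a -> 0 <= b -> sqmod z <= a ^+ 2 ->
  sqmod w <= b ^+ 2 -> sqmod (z + w) <= (a + b) ^+ 2.
Proof.
move=> a0 b0 za wb; rewrite /sqmod/=.
have h : z.1 * w.1 + z.2 * w.2 <= a * b.
  have [h|h] := leP (z.1 * w.1 + z.2 * w.2) 0; first by rewrite (le_trans h)// mulr_ge0.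
  rewrite -(@ler_pXn2r _ 2 isT) ?nnegrE ?mulr_ge0 ?(ltW h)// exprMn.
  apply: le_trans (ler_pM (sqmod_ge0 z) (sqmod_ge0 w) za wb).
  rewrite -subr_ge0 /sqmod (_ : _ - _ = (z.1 * w.2 - z.2 * w.1) ^+ 2) ?sqr_ge0//.
  ring.
rewrite /sqmod in za wb; nra.
Qed.

Lemma sqmodZ (r : R) z : sqmod (r *: z) = r ^+ 2 * sqmod z.
Proof.
rewrite /sqmod/=; have sE (a b : R) : a *: b = a * b by [].
by rewrite !sE; ring.
Qed.

Lemma sqmod_expi (t : R) : sqmod (expi t) = 1.
Proof. by rewrite /sqmod/= cos2Dsin2. Qed.

(** Adding [e * sqmod w] makes the sub-mean value inequality strict, so a maximum of the sum
    exceeding [e] could be attained neither inside nor on the circle. Then let [e] tend to 0. *)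
Lemma disc_maximum_principle (g : plane R -> \bar R) :
  usc_on (@closed_disc R) g -> (forall z, closed_disc z -> g z < +oo)%E ->
  (forall z r, 0 < r -> (forall w, closed_disc w -> disc (z + r *: w)) ->
    (g z <= ((2 * pi)^-1)%:E * \int[mu]_(t in `[0%R, (2 * pi)%R])
      g (z + r *: expi t)%R)%E) ->
  (forall z, circle z -> g z <= 0)%E ->
  forall z, closed_disc z -> (g z <= 0)%E.
Proof.
move=> ug goo gsub gcirc z cz; apply/lee_addgt0Pr => e e0; rewrite add0e.
pose f w := (g w + (e * sqmod w)%:E)%E.
have uf : usc_on (@closed_disc R) f.
  apply: usc_onD => // w.
  by apply: continuousM; [exact: cst_continuous|exact: continuous_sqmod].
have foo w : closed_disc w -> (f w < +oo)%E.
  by move=> /goo gw; rewrite /f lte_add_pinfty// ltry.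
have [z0 cz0 z0max] := usc_on_max (@compact_sqmod_le 1) (ex_intro _ z cz) uf foo.
have gf : (g z <= f z)%E by rewrite leeDl// lee_fin mulr_ge0 ?sqmod_ge0// ltW.
apply: (le_trans gf); apply: (le_trans (z0max z cz)).
rewrite leNgt; apply/negP => fz0.
have dz0 : sqmod z0 < 1.
  rewrite lt_neqAle cz0 andbT; apply/eqP => s1.
  move: fz0; rewrite /f s1 mulr1 ltNge => /negP; apply.
  by rewrite -[leRHS]add0e leeD2r// gcirc.
have [y gy] : exists y, g z0 = y%:E.
  move: fz0 (goo _ cz0); rewrite /f; case: (g z0) => [y|//|//]; by exists y.
(* [rho] is |z0| and [r] is half the distance from [z0] to the circle. *)
pose rho := Num.sqrt (sqmod z0); pose r := (1 - rho) / 2.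
have rho2 : rho ^+ 2 = sqmod z0 by rewrite sqr_sqrtr// sqmod_ge0.
have rho0 : 0 <= rho by exact: sqrtr_ge0.
have rho1 : rho < 1 by rewrite -(@ltr_pXn2r _ 2 isT) ?nnegrE// rho2 expr1n.
have r0 : 0 < r by rewrite divr_gt0// subr_gt0.
have inD w : closed_disc w -> disc (z0 + r *: w).
  move=> cw; rewrite /disc/=.
  apply: (@le_lt_trans _ _ ((rho + r) ^+ 2)).
    apply: sqmod_add_le => //; rewrite ?(ltW r0) ?rho2// sqmodZ.
    by rewrite ler_piMr// sqr_ge0.
  by rewrite expr_lt1//; rewrite /r; lra.
have := gsub z0 r r0 inD.
(* The bound on [g] at [z0 + r *: expi t] given by maximality of [f] at [z0]. It is a trigonometric
   polynomial of degree one with constant term [y - e * r ^+ 2], so its mean lies strictly below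
   [g z0]. *)
pose k (t : R) := y + e * sqmod z0 - e * sqmod (z0 + r *: expi t).
have kE t : k t = trig (y - e * r ^+ 2) (- (2 * e * r * z0.1)) (- (2 * e * r * z0.2)) t.
  have cs := cos2Dsin2 t; have sE (a b : R) : a *: b = a * b by [].
  rewrite /k /trig /sqmod/expi/= !sE.
  have -> : e * r ^+ 2 = e * r ^+ 2 * (cos t ^+ 2 + sin t ^+ 2) by rewrite cs mulr1.
  ring.
have gk (t : R) : (g (z0 + r *: expi t)%R <= (k t)%:E)%E.
  have ct : closed_disc (expi t) by rewrite /closed_disc/= sqmod_expi.
  have cd : closed_disc (z0 + r *: expi t) by apply: ltW; exact: inD.
  have := z0max _ cd; rewrite /f gy => h.
  by rewrite /k EFinB leeBrDr.
have Ik : \int[mu]_(t in `[0, 2 * pi]) k t = 2 * pi * (y - e * r ^+ 2).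
  under eq_Rintegral do rewrite kE.
  rewrite Rintegral_half_circle; last exact: continuous_trig.
  transitivity (\int[mu]_(t in `[0, pi]) (2 * (y - e * r ^+ 2))).
    by apply: eq_Rintegral => t _; rewrite /trig cosDpi sinDpi; ring.
  rewrite Rintegral_cst//.
  have mE := @lebesgue_measure_itv R `[0, pi].
  rewrite /= lte_fin ?pi_gt0// in mE.
  transitivity (2 * (y - e * r ^+ 2) * fine ((pi : R) - 0)%:E); last by rewrite /= subr0; ring.
  by congr (_ * fine _); exact: mE.
apply/negP; rewrite -ltNge gy.
apply: (@le_lt_trans _ _ (((2 * pi)^-1)%:E * \int[mu]_(t in `[0%R, (2 * pi)%R]) (k t)%:E)%E).
  rewrite lee_pmul2l ?lte_fin ?invr_gt0 ?mulr_gt0 ?pi_gt0//.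
  by apply: integral_le_nomeas => t _; exact: gk.
have ck : continuous k.
  by rewrite (_ : k = trig (y - e * r ^+ 2) (- (2 * e * r * z0.1)) (- (2 * e * r * z0.2)));
   [exact: continuous_trig|apply/funext].
rewrite -[X in (_ * X)%E]fineK; last first.
  exact: integrable_fin_num (continuous_itv_integrable 0 (2 * pi) ck).
rewrite [fine _]Ik -EFinM lte_fin mulrA mulVf ?mul1r ?gt_eqF ?mulr_gt0 ?pi_gt0//.
by rewrite gtrDl oppr_lt0 mulr_gt0// exprn_gt0.
Qed.

End disc_maximum_principle.

(** * The boundary data *)

Section potential.
Context {R : realType}.
Implicit Types (t v w : plane R) (s x : R).

Definition quad t v : R :=
  (sqmod v - t.1 * (v.1 ^+ 2 - v.2 ^+ 2) - 2 * t.2 * (v.1 * v.2)) / 2.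

(** One shape for both charts: [th_z] with (20, 1) in the affine chart and [th_w] with (1, 20) at
    infinity. *)
Definition pot (th : R -> R) (a b : R) t v : R :=
  ln (th (sqmod v)) + quad t v / 3 / (a + b * sqmod v) ^+ 2.

Definition th_z s : R := 1 + s * flat 0 (s - 1) / 4.
(** This is [s * th_z s^-1] for [s > 0]: the factor e comes from s/(1-s) = 1/(1-s) - 1. In this form
    it is smooth at 0, with value 1/4. *)
Definition th_w s : R := s + expR 1 * flat 0 (1 - s) / 4.

Lemma quad_ge0_le t v : circle t -> 0 <= quad t v <= sqmod v.
Proof.
move=> ct; rewrite /quad.
(* X + iY = v^2, so the claim is |Re(conj(t) v^2)| <= |v|^2, by Cauchy-Schwarz. *)
pose X := v.1 ^+ 2 - v.2 ^+ 2; pose Y := 2 * (v.1 * v.2).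
have TE : t.1 * X + t.2 * Y = t.1 * (v.1 ^+ 2 - v.2 ^+ 2) + 2 * t.2 * (v.1 * v.2).
  by rewrite /X/Y; ring.
have XY : X ^+ 2 + Y ^+ 2 = sqmod v ^+ 2 by rewrite /X/Y/sqmod; ring.
have h : (t.1 * X + t.2 * Y) ^+ 2 <= sqmod v ^+ 2.
  rewrite -XY -[leRHS]mul1r -(ct : sqmod t = 1) /sqmod -subr_ge0.
  rewrite (_ : _ - _ = (t.1 * Y - t.2 * X) ^+ 2) ?sqr_ge0//; ring.
have : `|t.1 * X + t.2 * Y| <= sqmod v.
  by rewrite -(@ler_pXn2r _ 2 isT) ?nnegrE ?sqmod_ge0// real_normK ?num_real.
rewrite ler_norml => /andP[h1 h2].
have s0 := sqmod_ge0 v.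
rewrite (_ : sqmod v - _ - _ = sqmod v - (t.1 * X + t.2 * Y)); last by rewrite TE; ring.
by apply/andP; split; lra.
Qed.

Lemma flat0_gt0E x : 0 < x -> flat 0 x = expR (- x^-1).
Proof. by move=> x0; rewrite /flat x0 expr0 mul1r. Qed.

Lemma th_z_gt0 s : 0 <= s -> 0 < th_z s.
Proof.
by move=> s0; rewrite /th_z ltr_pwDl// divr_ge0// mulr_ge0// flat_ge0.
Qed.

Lemma th_w_gt0 s : 0 <= s -> 0 < th_w s.
Proof.
move=> s0; rewrite /th_w; have [s1|s1] := ltP s 1.
  have s10 : 0 < 1 - s by lra.
  by rewrite ltr_wpDl// flat0_gt0E// divr_gt0// mulr_gt0// expR_gt0.
rewrite flat_le0; last lra.
by rewrite mulr0 mul0r addr0; lra.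
Qed.

Lemma th_wE s : 0 < s -> th_w s = s * th_z s^-1.
Proof.
move=> s0; rewrite /th_w /th_z mulrDr mulr1; congr (_ + _).
rewrite !mulrA divff ?gt_eqF// mul1r; congr (_ / 4).
have [s1|s1] := ltP s 1.
  have h1 : 0 < 1 - s by lra.
  have h2 : 0 < s^-1 - 1 by rewrite subr_gt0 invf_gt1.
  rewrite !flat0_gt0E// -expRD; congr expR; field.
  by rewrite mulN1r !gt_eqF.
rewrite !flat_le0 ?mulr0//; last lra.
by rewrite subr_le0 invf_le1.
Qed.

Lemma sqmod_gt0 w : (0 < sqmod w) = (w != 0).
Proof.
rewrite lt_neqAle sqmod_ge0 andbT eq_sym; congr (~~ _).
rewrite /sqmod paddr_eq0 ?sqr_ge0// !sqrf_eq0.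
by case: w => x y /=; rewrite [in RHS]xpair_eqE.
Qed.

Lemma sqmod_cinv w : sqmod (cinv w) = (sqmod w)^-1.
Proof.
rewrite /cinv {1}/sqmod/= !expr_div_n sqrrN -mulrDl -/(sqmod w).
have [->|s0] := eqVneq (sqmod w) 0; first by rewrite mul0r invr0.
by field.
Qed.

Definition cj t : plane R := (t.1, - t.2).

(** Q_tau(1/w) = Q_conj(tau)(w) / |w|^4, and squaring 20 + 1/|w|^2 = (1 + 20|w|^2) / |w|^2 cancels
    exactly this |w|^4. The remaining logarithm is the transition term between the two charts. *)
Lemma pot_cinv t w : w != 0 ->
  pot th_z 20 1 t (cinv w) = pot th_w 1 20 (cj t) w - ln (sqmod w).
Proof.
move=> w0; have s0 : 0 < sqmod w by rewrite sqmod_gt0.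
rewrite /pot sqmod_cinv th_wE// lnM ?posrE ?th_z_gt0 ?invr_ge0 ?sqmod_ge0//.
rewrite [ln _ + ln (th_z _)]addrC -!addrA; congr (_ + _).
rewrite [RHS]addrC subrK.
have -> : quad t (cinv w) = quad (cj t) w / sqmod w ^+ 2.
  rewrite /quad sqmod_cinv /cinv/=.
  move: s0; set S := sqmod w => s0.
  by field; rewrite gt_eqF.
move: (quad _ _) => Q; move: (sqmod w) s0 => S s0.
by field; repeat (apply/andP; split); apply: lt0r_neq0; lra.
Qed.

Definition fch (j : bool) t v : R :=
  if j then pot th_w 1 20 (cj t) v else pot th_z 20 1 t v.

Definition phi t (z : P1 R) : R :=
  if z is Some v then fch false t v - fs_pot v else fch true t 0 - fs_pot (0 : plane R).

Lemma phi_chart j t v : phi t (chart j v) = fch j t v - fs_pot v.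
Proof.
case: j => //=; case: eqVneq => [->//|v0] /=.
have s0 : 0 < sqmod v by rewrite sqmod_gt0.
rewrite pot_cinv// /fs_pot sqmod_cinv.
have -> : 1 + (sqmod v)^-1 = (1 + sqmod v) / sqmod v by field; rewrite gt_eqF.
have -> : ln ((1 + sqmod v) / sqmod v) = ln (1 + sqmod v) - ln (sqmod v).
  by rewrite ln_div// posrE; lra.
ring.
Qed.

Lemma Ck_pot {V : normedModType R} k (th : R -> R) (a b : R)
    (t1 t2 x y : V -> R) :
  (forall f : V -> R, Ck k f -> Ck k (fun q => th (f q))) ->
  (forall s, 0 <= s -> 0 < th s) -> 0 < a -> 0 < b ->
  Ck k t1 -> Ck k t2 -> Ck k x -> Ck k y ->
  Ck k (fun q => pot th a b (t1 q, t2 q) (x q, y q)).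
Proof.
move=> thC th0 a0 b0 C1 C2 Cx Cy.
have CN f c : Ck k f -> Ck k (fun q : V => c * f q) by move=> Cf; apply: CkM => //; exact: Ck_cst.
have Cs : Ck k (fun q : V => sqmod (x q, y q)) by apply: CkD; exact: CkM.
have m0 q : 0 < a + b * sqmod (x q, y q).
  by rewrite ltr_pwDl// mulr_ge0 ?sqmod_ge0// ltW.
apply: CkD.
  by apply: (Ck_ln (f := fun q => th (sqmod (x q, y q)))); [move=> q; exact/th0/sqmod_ge0|exact: thC].
apply: CkM; last first.
  apply: (CkV (f := fun q => (a + b * sqmod (x q, y q)) ^+ 2)).
    by move=> q; rewrite gt_eqF// exprn_gt0.
  by apply: CkM; (apply: CkD; [exact: Ck_cst|exact: CN]).
apply: CkM; last exact: Ck_cst.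
apply: CkM; last exact: Ck_cst.
have -> : (fun q => sqmod (x q, y q) - (t1 q, t2 q).1 * ((x q, y q).1 ^+ 2 - (x q, y q).2 ^+ 2)
    - 2 * (t1 q, t2 q).2 * ((x q, y q).1 * (x q, y q).2)) =
  (fun q => sqmod (x q, y q) + (-1) * (t1 q * (x q * x q + (-1) * (y q * y q))) +
    (- 2) * (t2 q * (x q * y q))).
  by apply/funext => q /=; ring.
apply: CkD; last by apply: (CN); do 2 apply: CkM => //.
apply: CkD => //; apply: (CN); apply: CkM => //; apply: CkD; first exact: CkM.
by apply: (CN); exact: CkM.
Qed.

Lemma Ck_fch {V : normedModType R} k j (t1 t2 x y : V -> R) :
  Ck k t1 -> Ck k t2 -> Ck k x -> Ck k y ->
  Ck k (fun q => fch j (t1 q, t2 q) (x q, y q)).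
Proof.
move=> C1 C2 Cx Cy; case: j; apply: Ck_pot => //.
- move=> f Cf; apply: CkD => //; apply: CkM; last exact: Ck_cst.
  apply: CkM; first exact: Ck_cst.
  apply: (Ck_comp (g := flat 0)); first exact: Ck_flat.
  under eq_fun do rewrite -mulN1r; apply: CkD; first exact: Ck_cst.
  by apply: CkM => //; exact: Ck_cst.
- exact: th_w_gt0.
- by under eq_fun do rewrite /= -mulN1r; apply: CkM => //; exact: Ck_cst.
- move=> f Cf; apply: CkD; first exact: Ck_cst.
  apply: CkM; last exact: Ck_cst.
  apply: CkM => //; apply: (Ck_comp (g := flat 0)); first exact: Ck_flat.
  by apply: CkD => //; exact: Ck_cst.
- exact: th_z_gt0.
Qed.

(** General parametrisations of [t] and [v] cover both the joint smoothness in the angle and the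
    smoothness for fixed [t]. *)
Lemma Ck_phi {V : normedModType R} k j (t v : V -> plane R) :
  Ck k (fun q => (t q).1) -> Ck k (fun q => (t q).2) ->
  Ck k (fun q => (v q).1) -> Ck k (fun q => (v q).2) ->
  Ck k (fun q => phi (t q) (chart j (v q))).
Proof.
move=> C1 C2 Cx Cy.
have -> : (fun q => phi (t q) (chart j (v q))) = (fun q =>
    fch j ((t q).1, (t q).2) ((v q).1, (v q).2) +
    (-1) * ln (1 + ((v q).1 * (v q).1 + (v q).2 * (v q).2))).
  by apply/funext => q; rewrite phi_chart mulN1r -!surjective_pairing.
apply: CkD; first exact: Ck_fch.
apply: CkM; first exact: Ck_cst.
apply: (Ck_ln (f := fun q => 1 + ((v q).1 * (v q).1 + (v q).2 * (v q).2))).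
  by move=> q; rewrite ltr_pwDl// addr_ge0// -expr2 sqr_ge0.
by apply: CkD; [exact: Ck_cst|apply: CkD; exact: CkM].
Qed.

Lemma smooth_family_phi : smooth_family phi.
Proof.
move=> j k; apply: Ck_phi.
- apply: (Ck_comp (g := cos)); first exact: (Ck_sin_cos k).2.
  by apply: Ck_linear => [q|v q h]; [exact: cvg_snd|].
- apply: (Ck_comp (g := sin)); first exact: (Ck_sin_cos k).1.
  by apply: Ck_linear => [q|v q h]; [exact: cvg_snd|].
- apply: Ck_linear => [q|v q h] //.
  by apply: (@continuous_comp _ _ _ (fun q : plane R * R => q.1) fst); exact: cvg_fst.
- apply: Ck_linear => [q|v q h] //.
  by apply: (@continuous_comp _ _ _ (fun q : plane R * R => q.1) snd);
    [exact: cvg_fst|exact: cvg_snd].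
Qed.

Lemma smooth_P1_phi t : smooth_P1 (phi t).
Proof.
move=> j k; apply: (@Ck_phi _ k j (fun=> t) id).
- exact: Ck_cst.
- exact: Ck_cst.
- by apply: Ck_linear => [q|v q h] //; exact: cvg_fst.
- by apply: Ck_linear => [q|v q h] //; exact: cvg_snd.
Qed.

End potential.

(** * Positivity of the boundary forms *)

Section derivation_rules.
Context {R : realType} {V : normedModType R}.
Implicit Types (f g : V -> R) (x v : V).

Lemma is_derive_mul f g x v (df dg : R) : is_derive x v f df -> is_derive x v g dg ->
  is_derive x v (fun y => f y * g y) (df * g x + f x * dg).
Proof.
move=> hf hg; apply: (is_derive_eq (is_deriveM hf hg)).
by rewrite addrC [g x *: df]mulrC.
Qed.

Lemma is_derive_add f g x v (df dg : R) : is_derive x v f df -> is_derive x v g dg ->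
  is_derive x v (fun y => f y + g y) (df + dg).
Proof. exact: is_deriveD. Qed.

Lemma is_derive_const (c : R) x v : is_derive x v (fun=> c) (0 : R).
Proof. exact: is_derive_cst. Qed.

Lemma is_derive_inv f x v (df : R) : f x != 0 -> is_derive x v f df ->
  is_derive x v (fun y => (f y)^-1) (- ((f x)^-1 * (f x)^-1) * df).
Proof.
move=> fx0 [fd fE]; split; first exact: derivableV.
by rewrite deriveV// fE -invfM.
Qed.

Lemma derive2E (f : V -> R) (df ddf : V -> R) x v :
  (forall y, is_derive y v f (df y)) -> is_derive x v df (ddf x) ->
  'D_v (fun y => 'D_v f y) x = ddf x.
Proof.
move=> h1 [_ h2]; rewrite -h2; congr ('D_v _ x).
by apply/funext => y; case: (h1 y).
Qed.

End derivation_rules.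

(** * The Laplacian of the boundary potentials *)

Section laplacian_pot.
Context {R : realType} (th th1 th2 : R -> R) (a b : R) (t : plane R).
Context (dth : forall s : R, is_derive s 1 th (th1 s)).
Context (dth1 : forall s : R, is_derive s 1 th1 (th2 s)).
Context (th0 : forall s, 0 <= s -> 0 < th s) (a0 : 0 < a) (b0 : 0 < b).
Implicit Types (y v : plane R).

Definition dS v y : R := 2 * (y.1 * v.1 + y.2 * v.2).
Definition dQ v y : R := y.1 * v.1 + y.2 * v.2 - t.1 * (y.1 * v.1 - y.2 * v.2)
  - t.2 * (y.1 * v.2 + y.2 * v.1).
Definition mW y : R := (a + b * sqmod y)^-1.
Definition dW v y : R := - (mW y * mW y) * (b * dS v y).

Lemma is_derive_fst y v : is_derive y v (fun z : plane R => z.1) v.1.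
Proof. by apply: is_derive_linear. Qed.

Lemma is_derive_snd y v : is_derive y v (fun z : plane R => z.2) v.2.
Proof. by apply: is_derive_linear. Qed.

Lemma is_derive_sqmod y v : is_derive y v (@sqmod R) (dS v y).
Proof.
apply: (is_derive_eq (is_derive_add
  (is_derive_mul (is_derive_fst y v) (is_derive_fst y v))
  (is_derive_mul (is_derive_snd y v) (is_derive_snd y v)))).
rewrite /dS; ring.
Qed.

Lemma is_derive_dS y v : is_derive y v (dS v) (2 * sqmod v).
Proof.
apply: (is_derive_eq (is_derive_mul (is_derive_const 2 y v) (is_derive_add
  (is_derive_mul (is_derive_fst y v) (is_derive_const v.1 y v))
  (is_derive_mul (is_derive_snd y v) (is_derive_const v.2 y v))))).
rewrite /sqmod; ring.
Qed.

Lemma is_derive_dQ y v : is_derive y v (dQ v) (2 * quad t v).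
Proof.
have dx := is_derive_fst y v; have dy := is_derive_snd y v.
have k c := is_derive_const c y v.
have h := is_derive_add (is_derive_mul (k (v.1 - t.1 * v.1 - t.2 * v.2)) dx)
  (is_derive_mul (k (v.2 + t.1 * v.2 - t.2 * v.1)) dy).
rewrite (_ : dQ v = fun y => (v.1 - t.1 * v.1 - t.2 * v.2) * y.1 +
    (v.2 + t.1 * v.2 - t.2 * v.1) * y.2); last first.
  by apply/funext => z; rewrite /dQ; ring.
by apply: (is_derive_eq h); rewrite /quad /sqmod; field.
Qed.

Lemma is_derive_quad y v : is_derive y v (quad t) (dQ v y).
Proof.
have dx := is_derive_fst y v; have dy := is_derive_snd y v.
have k c := is_derive_const c y v.
have h := is_derive_add (is_derive_add
  (is_derive_mul (k ((1 - t.1) / 2)) (is_derive_mul dx dx))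
  (is_derive_mul (k ((1 + t.1) / 2)) (is_derive_mul dy dy)))
  (is_derive_mul (k (- t.2)) (is_derive_mul dx dy)).
rewrite (_ : quad t = fun y => (1 - t.1) / 2 * (y.1 * y.1) +
    (1 + t.1) / 2 * (y.2 * y.2) + - t.2 * (y.1 * y.2)); last first.
  by apply/funext => z; rewrite /quad /sqmod; field.
by apply: (is_derive_eq h); rewrite /dQ; field.
Qed.

Lemma mW_neq0 y : a + b * sqmod y != 0.
Proof. by rewrite gt_eqF// ltr_pwDl// mulr_ge0 ?sqmod_ge0// ltW. Qed.

Lemma is_derive_mW y v : is_derive y v mW (dW v y).
Proof.
have h := is_derive_inv (f := fun y => a + b * sqmod y) (mW_neq0 y)
  (is_derive_add (is_derive_const a y v)
    (is_derive_mul (is_derive_const b y v) (is_derive_sqmod y v))).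
by apply: (is_derive_eq h); rewrite /dW /mW; ring.
Qed.

Definition iT y : R := (th (sqmod y))^-1.

Lemma is_derive_iT y v :
  is_derive y v iT (- (iT y * iT y) * (th1 (sqmod y) * dS v y)).
Proof.
apply: is_derive_inv; first by rewrite gt_eqF// th0// sqmod_ge0.
exact: is_derive_comp (is_derive_sqmod y v) (dth _).
Qed.

Lemma laplacian_pot y v : let s := sqmod y in
  'D_v (fun z => 'D_v (pot th a b t) z) y +
  'D_(mulI v) (fun z => 'D_(mulI v) (pot th a b t) z) y =
  sqmod v * (4 * (iT y * (th1 s + s * th2 s) - s * (iT y * th1 s) ^+ 2) +
   (2 * mW y ^+ 2 - 24 * quad t y * b * mW y ^+ 3 +
    24 * quad t y * s * b ^+ 2 * mW y ^+ 4) / 3).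
Proof.
pose du w z := iT z * (th1 (sqmod z) * dS w z) +
  3^-1 * (dQ w z * (mW z * mW z) + quad t z * (2 * (mW z * dW w z))).
pose ddW w z := - b * (2 * (mW z * (dW w z * dS w z)) + mW z * mW z * (2 * sqmod w)).
pose ddu w z := - (iT z * iT z) * (th1 (sqmod z) * dS w z) * (th1 (sqmod z) * dS w z) +
  iT z * (th2 (sqmod z) * dS w z * dS w z + th1 (sqmod z) * (2 * sqmod w)) +
  3^-1 * (2 * quad t w * (mW z * mW z) + 4 * (dQ w z * (mW z * dW w z)) +
     2 * quad t z * (dW w z * dW w z + mW z * ddW w z)).
have h1 w z : is_derive z w (pot th a b t) (du w z).
  have k c := is_derive_const c z w.
  have dl : is_derive z w (fun z => ln (th (sqmod z))) (iT z * (th1 (sqmod z) * dS w z)).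
    apply: (is_derive_comp (g := @ln R) (f := fun z => th (sqmod z))).
      exact: is_derive_comp (is_derive_sqmod z w) (dth _).
    by apply: is_derive1_ln; apply: th0; exact: sqmod_ge0.
  have h := is_derive_add dl (is_derive_mul (k 3^-1) (is_derive_mul (is_derive_quad z w)
    (is_derive_mul (is_derive_mW z w) (is_derive_mW z w)))).
  rewrite (_ : pot th a b t = fun z => ln (th (sqmod z)) +
     3^-1 * (quad t z * (mW z * mW z))); last first.
    by apply/funext => q; rewrite /pot /mW -invfM; ring.
  apply: (is_derive_eq h); rewrite /du; ring.
have h2 w z : is_derive z w (du w) (ddu w z).
  have k c := is_derive_const c z w.
  have dth1S := is_derive_comp (is_derive_sqmod z w) (dth1 _).
  have ddWE : is_derive z w (dW w) (ddW w z).
    have h := is_derive_mul (k (- b)) (is_derive_mul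
      (is_derive_mul (is_derive_mW z w) (is_derive_mW z w)) (is_derive_dS z w)).
    rewrite (_ : dW w = fun y => - b * (mW y * mW y * dS w y)); last first.
      by apply/funext => q; rewrite /dW; ring.
    by apply: (is_derive_eq h); rewrite /ddW; ring.
  have h := is_derive_add (is_derive_mul (is_derive_iT z w)
      (is_derive_mul dth1S (is_derive_dS z w)))
    (is_derive_mul (k 3^-1) (is_derive_add
      (is_derive_mul (is_derive_dQ z w) (is_derive_mul (is_derive_mW z w) (is_derive_mW z w)))
      (is_derive_mul (is_derive_quad z w) (is_derive_mul (k 2)
         (is_derive_mul (is_derive_mW z w) ddWE))))).
  apply: (is_derive_eq h); rewrite /ddu; ring.
move=> s; rewrite !(derive2E (h1 _) (h2 _ _)) /ddu /ddW /dW -/s.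
move: (iT y) (mW y) (th1 s) (th2 s) => I W T1 T2.
rewrite /dS /dQ /mulI /quad /s /sqmod /=.
by field.
Qed.

End laplacian_pot.

(** * Curvature bounds in the two charts *)

Section kahler.
Context {R : realType}.
Implicit Types (s q r : R) (t v : plane R).

Definition th_z1 s : R := (flat 0 (s - 1) + s * flat 2 (s - 1)) / 4.
Definition th_z2 s : R :=
  (2 * flat 2 (s - 1) + s * (flat 4 (s - 1) - 2 * flat 3 (s - 1))) / 4.
Definition th_w1 s : R := 1 - expR 1 * flat 2 (1 - s) / 4.
Definition th_w2 s : R := expR 1 * (flat 4 (1 - s) - 2 * flat 3 (1 - s)) / 4.

Lemma is_derive_flat_affine n (c d s : R) :
  is_derive s 1 (fun x => flat n (c * x + d))
    ((flat n.+2 (c * s + d) - n%:R * flat n.+1 (c * s + d)) * c).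
Proof.
have dl : is_derive s 1 (fun x : R => c * x + d) c.
  apply: (is_derive_eq (is_derive_add (is_derive_mul (is_derive_const c s 1)
    (is_derive_id s 1)) (is_derive_const d s 1))); ring.
exact: is_derive_comp dl (is_derive_flat n (c * s + d)).
Qed.

Lemma is_derive_th_z s : is_derive s 1 th_z (th_z1 s).
Proof.
have h := is_derive_add (is_derive_const 1 s 1) (is_derive_mul (is_derive_mul
  (is_derive_id s 1) (is_derive_flat_affine 0 1 (-1) s)) (is_derive_const 4^-1 s 1)).
rewrite (_ : th_z = fun x => 1 + x * flat 0 (1 * x + - 1) / 4); last first.
  by apply/funext => x; rewrite mul1r.
by apply: (is_derive_eq h); rewrite /th_z1 !mul1r; field.
Qed.

Lemma is_derive_th_z1 s : is_derive s 1 th_z1 (th_z2 s).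
Proof.
have h := is_derive_mul (is_derive_add (is_derive_flat_affine 0 1 (-1) s)
  (is_derive_mul (is_derive_id s 1) (is_derive_flat_affine 2 1 (-1) s)))
  (is_derive_const 4^-1 s 1).
rewrite (_ : th_z1 = fun x => (flat 0 (1 * x + - 1) + x * flat 2 (1 * x + - 1)) / 4).
  by apply: (is_derive_eq h); rewrite /th_z2 !mul1r; field.
by apply/funext => x; rewrite mul1r.
Qed.

Lemma is_derive_th_w s : is_derive s 1 th_w (th_w1 s).
Proof.
have h := is_derive_add (is_derive_id s 1) (is_derive_mul (is_derive_mul
  (is_derive_const (expR 1) s 1) (is_derive_flat_affine 0 (-1) 1 s))
  (is_derive_const 4^-1 s 1)).
rewrite (_ : th_w = fun x => x + expR 1 * flat 0 (-1 * x + 1) / 4); last first.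
  by apply/funext => x; rewrite mulN1r [- x + 1]addrC.
by apply: (is_derive_eq h); rewrite /th_w1 !mulN1r [- s + 1]addrC; field.
Qed.

Lemma is_derive_th_w1 s : is_derive s 1 th_w1 (th_w2 s).
Proof.
have h := is_derive_add (is_derive_const 1 s 1) (is_derive_mul (is_derive_mul
  (is_derive_const (- expR 1) s 1) (is_derive_flat_affine 2 (-1) 1 s))
  (is_derive_const 4^-1 s 1)).
rewrite (_ : th_w1 = fun x => 1 + - expR 1 * flat 2 (-1 * x + 1) / 4); last first.
  by apply/funext => x; rewrite mulN1r [- x + 1]addrC /th_w1; ring.
by apply: (is_derive_eq h); rewrite /th_w2 !mulN1r [- s + 1]addrC; field.
Qed.

(** Fourth power of e^(-1/4) >= 3/4. *)
Lemma expRN1_ge : 81 / 256 <= expR (- 1) :> R.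
Proof.
have -> : - 1 = - (4^-1) * 4%:R :> R by field.
rewrite expRM_natr (_ : 81 / 256 = (3 / 4) ^+ 4 :> R); last by field.
apply: lerXn2r; rewrite ?nnegrE ?expR_ge0//.
by apply: le_trans (expR_ge1Dx _); lra.
Qed.

Lemma flatE n r : 0 < r -> flat n r = r^-1 ^+ n * expR (- r^-1).
Proof. by move=> r0; rewrite /flat r0. Qed.

(* A quarter of the Laplacian of [v |-> ln (th (sqmod v))], for [sqmod v = s]. *)
Definition rlap (th th1 th2 : R -> R) s : R :=
  (th s)^-1 * (th1 s + s * th2 s) - s * ((th s)^-1 * th1 s) ^+ 2.

Lemma rlap_z_le1 s : s <= 1 -> rlap th_z th_z1 th_z2 s = 0.
Proof.
move=> s1; rewrite /rlap /th_z1 /th_z2 !flat_le0 ?subr_le0//.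
by rewrite !(mulr0, mul0r, addr0, subr0, expr0n, oppr0).
Qed.

(** With r = s - 1, the left side of the goal's lower bound is compared with E N / (4 r^4 th^2), the
    exact value of [rlap]. The term of N containing E is controlled by sE <= r, which is e^(1/r) >=
    1 + 1/r, and the quartic left over exceeds r^4/2. *)
Lemma rlap_z_ge s : 1 < s ->
  expR (- (s - 1)^-1) / 8 / th_z s ^+ 2 <= rlap th_z th_z1 th_z2 s.
Proof.
move=> s1; have r0 : 0 < s - 1 by rewrite subr_gt0.
have th0 := @th_z_gt0 _ s (ltW (lt_trans ltr01 s1)).
rewrite /rlap /th_z1 /th_z2; move: th0; rewrite /th_z !flatE//.
set r := s - 1 in r0 *; set E := expR (- r^-1).
have sE : s = 1 + r by rewrite /r; ring.
have E0 : 0 < E by exact: expR_gt0.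
have Er : s * E <= r.
  rewrite /E expRN ler_pdivrMr ?expR_gt0// sE.
  apply: le_trans (_ : r * (1 + r^-1) <= _); last by rewrite ler_pM2l// expR_ge1Dx.
  by rewrite mulrDr mulr1 divff ?gt_eqF// addrC.
rewrite expr0 mul1r; set th := 1 + _ => th0.
set N := r ^+ 4 + 3 * s * r ^+ 2 + s ^+ 2 - 2 * s ^+ 2 * r -
  s ^+ 2 * E / 4 * r * (2 * s - r).
have NE : N = (3 / 4 * r ^+ 4 + r ^+ 3 / 4 - r ^+ 2 / 2 + 1) +
    s * (s + 1) * r / 4 * (r - s * E).
  by rewrite /N sE; field.
have Nge : r ^+ 4 / 2 <= N.
  have h1 : 0 <= s * (s + 1) * r / 4 * (r - s * E).
    apply: mulr_ge0; last by rewrite subr_ge0.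
    by rewrite divr_ge0// !mulr_ge0//; lra.
  have h2 : 0 <= r ^+ 3 by rewrite exprn_ge0// ltW.
  have h3 := sqr_ge0 (r ^+ 2 - 1).
  rewrite NE; nra.
apply: (@le_trans _ _ (E / (4 * r ^+ 4 * th ^+ 2) * N)); last first.
  rewrite le_eqVlt; apply/orP; left; apply/eqP.
  have thE : th = 1 + s * E / 4 by [].
  rewrite /N thE; rewrite thE in th0.
  move: th0; rewrite sE => th0; field.
  by apply/andP; split; apply: lt0r_neq0; lra.
rewrite [leRHS](_ : _ = E / th ^+ 2 * (N / (4 * r ^+ 4))); last first.
  by field; apply/andP; split; apply: lt0r_neq0.
rewrite [leLHS](_ : _ = E / th ^+ 2 * 8^-1); last by field; exact: lt0r_neq0.
rewrite ler_pM2l ?divr_gt0 ?exprn_gt0// ler_pdivlMr ?mulr_gt0 ?exprn_gt0//.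
by apply: le_trans Nge; lra.
Qed.

Lemma rlap_w_ge1 s : 1 <= s -> rlap th_w th_w1 th_w2 s = 0.
Proof.
move=> s1; rewrite /rlap /th_w /th_w1 /th_w2 !flat_le0 ?subr_le0//.
rewrite !(mulr0, mul0r, addr0, subr0, mulr1).
have s0 : s != 0 by rewrite gt_eqF//; lra.
by field.
Qed.

(** Same scheme as for [rlap_z_ge], with r = 1 - s and [A] the flat part of [th_w]; here A <= r/4
    comes from e^(1/r - 1) >= 1/r. *)
Lemma rlap_w_ge s : 0 <= s -> s < 1 ->
  let A := expR 1 * expR (- (1 - s)^-1) / 4 in
  [/\ 0 < A, A <= (1 - s) / 4, th_w s = s + A &
      A / 2 / th_w s ^+ 2 <= rlap th_w th_w1 th_w2 s].
Proof.
move=> s0 s1; have r0 : 0 < 1 - s by rewrite subr_gt0.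
have th0 := th_w_gt0 s0.
rewrite /rlap /th_w1 /th_w2; move: th0; rewrite /th_w !flatE//.
set r := 1 - s in r0 *; set E := expR (- r^-1).
have sE : s = 1 - r by rewrite /r; ring.
rewrite expr0 mul1r; set A := expR 1 * E / 4; set th := s + A => th0.
have A0 : 0 < A by rewrite divr_gt0// mulr_gt0// expR_gt0.
have Ar : A <= r / 4.
  rewrite ler_pM2r ?invr_gt0// /E -expRD -[1 - r^-1]opprB expRN.
  rewrite -[leRHS]invrK lef_pV2 ?posrE ?expR_gt0 ?invr_gt0//.
  by apply: le_trans (expR_ge1Dx _); lra.
split => //.
set N := r ^+ 4 + s * r ^+ 2 + s ^+ 2 - 2 * s ^+ 2 * r - A * r * (r + 2 * s).
have NE : N = (r ^+ 4 - 11 / 4 * r ^+ 3 + 11 / 2 * r ^+ 2 - 4 * r + 1) +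
    r * (1 + s) * (r / 4 - A).
  by rewrite /N sE; field.
have Nge : r ^+ 4 / 2 <= N.
  have h1 : 0 <= r * (1 + s) * (r / 4 - A).
    by rewrite mulr_ge0 ?subr_ge0// mulr_ge0//; lra.
  (* Half of this square matches the two leading terms of the quartic minus r^4/2; the next square
     disposes of the quadratic remainder for 0 < r <= 1. *)
  have h3 := sqr_ge0 (r ^+ 2 - 11 / 4 * r + 6 / 5).
  have h4 := sqr_ge0 (r - 2 / 3).
  rewrite NE; nra.
apply: (@le_trans _ _ (A / (r ^+ 4 * th ^+ 2) * N)); last first.
  rewrite le_eqVlt; apply/orP; left; apply/eqP.
  have E4 : expR 1 * E = 4 * A by rewrite /A; field.
  have -> : expR 1 * (r^-1 ^+ 2 * E) = 4 * A * r^-1 ^+ 2 by rewrite -E4; ring.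
  have -> : expR 1 * (r^-1 ^+ 4 * E - 2 * (r^-1 ^+ 3 * E)) =
      4 * A * (r^-1 ^+ 4 - 2 * r^-1 ^+ 3) by rewrite -E4; ring.
  rewrite /N.
  have thE : th = s + A by [].
  rewrite thE; rewrite thE in th0; move: th0; rewrite sE => th0; field.
  by apply/andP; split; apply: lt0r_neq0; lra.
rewrite [leRHS](_ : _ = A / th ^+ 2 * (N / r ^+ 4)); last first.
  by field; apply/andP; split; apply: lt0r_neq0.
rewrite [leLHS](_ : _ = A / th ^+ 2 * 2^-1); last by field; exact: lt0r_neq0.
rewrite ler_pM2l; last by rewrite divr_gt0// exprn_gt0.
by rewrite ler_pdivlMr ?exprn_gt0// mulrC.
Qed.

(** For s <= 2 the damped term alone is positive, as 2(20+s)^2 - 480q >= 400(2-s) + 2s^2. For s > 2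
    it is at least -2/(4+s)^2, because 80s <= (20+s)^2, whereas 4 [rlap] is at least
    (81/32)/(4+s)^2, and 81/32 > 2. *)
Lemma laplacian_z_gt0 s q : 0 <= q -> q <= s -> forall W, W = (20 + 1 * s)^-1 ->
  0 < 4 * rlap th_z th_z1 th_z2 s +
   (2 * W ^+ 2 - 24 * q * 1 * W ^+ 3 + 24 * q * s * 1 ^+ 2 * W ^+ 4) / 3.
Proof.
move=> q0 qs W WE; have s0 : 0 <= s by exact: le_trans qs.
have m0 : 0 < 20 + 1 * s by lra.
have BE : 2 * W ^+ 2 - 24 * q * 1 * W ^+ 3 + 24 * q * s * 1 ^+ 2 * W ^+ 4 =
    W ^+ 4 * (2 * (20 + s) ^+ 2 - 480 * q).
  by rewrite WE; field; apply: lt0r_neq0; lra.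
have W0 : 0 < W by rewrite WE invr_gt0.
rewrite BE; have [s2|s2] := leP s 2.
  apply: ltr_wpDl.
    rewrite mulr_ge0//; have [s1|s1] := leP s 1; first by rewrite rlap_z_le1.
    apply: le_trans (rlap_z_ge s1).
    by rewrite divr_ge0 ?sqr_ge0// divr_ge0// expR_ge0.
  apply: divr_gt0; last by [].
  apply: mulr_gt0; first exact: exprn_gt0.
  have -> : 2 * (20 + s) ^+ 2 - 480 * q = 400 * (2 - s) + 2 * s ^+ 2 + 480 * (s - q) by ring.
  have := sqr_ge0 (s - 1); lra.
have s1 : 1 < s by lra.
have E1 : 81 / 256 <= expR (- (s - 1)^-1).
  apply: le_trans expRN1_ge _; rewrite ler_expR lerN2 invf_le1; lra.
have th4 : th_z s <= (4 + s) / 4.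
  rewrite /th_z flat0_gt0E ?subr_gt0//.
  have : expR (- (s - 1)^-1) <= 1.
    by rewrite expR_le1 oppr_le0 invr_ge0; lra.
  nra.
have th0 := @th_z_gt0 _ s s0.
have L4 : 81 / 128 / (4 + s) ^+ 2 <= rlap th_z th_z1 th_z2 s.
  apply: le_trans (rlap_z_ge s1).
  rewrite [leLHS](_ : _ = (81 / 256) / 8 / ((4 + s) / 4) ^+ 2); last first.
    by field; apply: lt0r_neq0; lra.
  apply: ler_pM; [lra|by rewrite invr_ge0 sqr_ge0|lra|].
  rewrite lef_pV2 ?posrE ?exprn_gt0//; last lra.
  by rewrite lerXn2r ?nnegrE//; lra.
have W4 : W ^+ 4 * (80 * s) <= ((4 + s) ^+ 2)^-1.
  rewrite (_ : W ^+ 4 * _ = 80 * s / (20 + s) ^+ 4); last first.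
    by rewrite WE mul1r exprVn mulrC.
  rewrite ler_pdivrMr ?exprn_gt0//; last lra.
  rewrite ler_pdivlMl ?exprn_gt0//; last lra.
  have h1 : 80 * s <= (20 + s) ^+ 2.
    rewrite -subr_ge0 (_ : _ - _ = (20 - s) ^+ 2) ?sqr_ge0//; ring.
  have h2 : (4 + s) ^+ 2 <= (20 + s) ^+ 2 by rewrite lerXn2r ?nnegrE//; lra.
  rewrite (_ : (20 + s) ^+ 4 = (20 + s) ^+ 2 * (20 + s) ^+ 2); last by ring.
  by apply: ler_pM => //; rewrite ?sqr_ge0//; lra.
have B : - (6 * (W ^+ 4 * (80 * s))) <= W ^+ 4 * (2 * (20 + s) ^+ 2 - 480 * q).
  rewrite (_ : - _ = W ^+ 4 * (- (480 * s))); last by ring.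
  rewrite ler_pM2l ?exprn_gt0//; have := sqr_ge0 (20 + s); lra.
have i0 : 0 < ((4 + s) ^+ 2)^-1 by rewrite invr_gt0 exprn_gt0//; lra.
lra.
Qed.

(** The estimates of [laplacian_z_gt0] transported by s -> 1/s: the threshold 2 becomes 1/2 and 4 +
    s becomes 1 + 4s. *)
Lemma laplacian_w_gt0 s q : 0 <= q -> q <= s -> forall W, W = (1 + 20 * s)^-1 ->
  0 < 4 * rlap th_w th_w1 th_w2 s +
   (2 * W ^+ 2 - 24 * q * 20 * W ^+ 3 + 24 * q * s * 20 ^+ 2 * W ^+ 4) / 3.
Proof.
move=> q0 qs W WE; have s0 : 0 <= s by exact: le_trans qs.
have m0 : 0 < 1 + 20 * s by lra.
have BE : 2 * W ^+ 2 - 24 * q * 20 * W ^+ 3 + 24 * q * s * 20 ^+ 2 * W ^+ 4 =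
    W ^+ 4 * (2 * (1 + 20 * s) ^+ 2 - 480 * q).
  by rewrite WE; field; apply: lt0r_neq0; lra.
have W0 : 0 < W by rewrite WE invr_gt0.
rewrite BE; have [s2|s2] := leP 2^-1 s.
  apply: ltr_wpDl.
    rewrite mulr_ge0//; have [s1|s1] := leP 1 s; first by rewrite rlap_w_ge1.
    have [A0 _ _] := rlap_w_ge s0 s1; apply: le_trans.
    by rewrite divr_ge0 ?sqr_ge0// divr_ge0// ltW.
  have h1 : 0 <= s * (2 * s - 1) by rewrite mulr_ge0//; lra.
  apply: divr_gt0; last by [].
  apply: mulr_gt0; first exact: exprn_gt0.
  have -> : 2 * (1 + 20 * s) ^+ 2 - 480 * q =
    2 + 400 * (s * (2 * s - 1)) + 480 * (s - q) by ring.
  lra.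
have s1 : s < 1 by lra.
have [A0 Ale thE] := rlap_w_ge s0 s1; rewrite thE.
have A1 : 81 / 1024 <= expR 1 * expR (- (1 - s)^-1) / 4.
  have : 81 / 256 <= expR 1 * expR (- (1 - s)^-1).
    apply: le_trans expRN1_ge _; rewrite -expRD ler_expR.
    rewrite -subr_ge0.
    have -> : 1 - (1 - s)^-1 - - 1 = (1 - 2 * s) / (1 - s).
      by field; apply: lt0r_neq0; lra.
    by rewrite divr_ge0; lra.
  lra.
move: A0 Ale A1; set A := _ / 4 => A0 Ale A1 L.
have L4 : 81 / 128 / (1 + 4 * s) ^+ 2 <= rlap th_w th_w1 th_w2 s.
  apply: le_trans L.
  rewrite [leLHS](_ : _ = (81 / 1024) / 2 / ((1 + 4 * s) / 4) ^+ 2); last first.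
    by field; apply: lt0r_neq0; lra.
  apply: ler_pM; [lra|by rewrite invr_ge0 sqr_ge0|lra|].
  rewrite lef_pV2 ?posrE ?exprn_gt0//; [|lra|lra].
  by rewrite lerXn2r ?nnegrE//; lra.
have W4 : W ^+ 4 * (80 * s) <= ((1 + 4 * s) ^+ 2)^-1.
  rewrite (_ : W ^+ 4 * _ = 80 * s / (1 + 20 * s) ^+ 4); last first.
    by rewrite WE exprVn mulrC.
  rewrite ler_pdivrMr ?exprn_gt0//.
  rewrite ler_pdivlMl ?exprn_gt0//; last lra.
  have h1 : 80 * s <= (1 + 20 * s) ^+ 2.
    rewrite -subr_ge0 (_ : _ - _ = (1 - 20 * s) ^+ 2) ?sqr_ge0//; ring.
  have h2 : (1 + 4 * s) ^+ 2 <= (1 + 20 * s) ^+ 2 by rewrite lerXn2r ?nnegrE//; lra.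
  rewrite (_ : (1 + 20 * s) ^+ 4 = (1 + 20 * s) ^+ 2 * (1 + 20 * s) ^+ 2); last by ring.
  by apply: ler_pM => //; rewrite ?sqr_ge0//; lra.
have B : - (6 * (W ^+ 4 * (80 * s))) <= W ^+ 4 * (2 * (1 + 20 * s) ^+ 2 - 480 * q).
  rewrite (_ : - _ = W ^+ 4 * (- (480 * s))); last by ring.
  rewrite ler_pM2l ?exprn_gt0//; have := sqr_ge0 (1 + 20 * s); lra.
have i0 : 0 < ((1 + 4 * s) ^+ 2)^-1 by rewrite invr_gt0 exprn_gt0//; lra.
lra.
Qed.

Lemma kahler_potential_phi t : circle t -> kahler_potential (phi t).
Proof.
move=> ct; split; first exact: smooth_P1_phi.
move=> j w xi xi0.
have x0 : 0 < sqmod xi by rewrite sqmod_gt0.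
have -> : (fun y : plane R => fs_pot y + phi t (chart j y)) = fch j t.
  by apply/funext => y; rewrite phi_chart addrC subrK.
rewrite /ddc mulr_gt0 ?invr_gt0 ?mulr_gt0 ?pi_gt0//.
case: j.
  have ct' : circle (cj t) by rewrite /circle /= /sqmod /= sqrrN; exact: ct.
  have /andP[q0 qs] := quad_ge0_le w ct'.
  rewrite [fch true t](_ : _ = pot th_w 1 20 (cj t))//.
  rewrite (laplacian_pot _ is_derive_th_w is_derive_th_w1 (@th_w_gt0 R) ltr01)//.
  by rewrite mulr_gt0//; exact: laplacian_w_gt0.
have /andP[q0 qs] := quad_ge0_le w ct.
rewrite [fch false t](_ : _ = pot th_z 20 1 t)//.
rewrite (laplacian_pot _ is_derive_th_z is_derive_th_z1 (@th_z_gt0 R) _ ltr01)//.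
by rewrite mulr_gt0//; exact: laplacian_z_gt0.
Qed.

End kahler.

(** * The current dd^c log (e + |w|^2) *)

Section ln_current.
Context {R : realType}.
Notation mR := (measurableTypeR R).
Notation T4 := ((mR * mR) * (mR * mR))%type.
Notation mu := (@leb4 R).
Implicit Types (e m c r : R) (v : plane2 R) (K U : set (plane2 R)).

Lemma ln1B_ge (x : R) : x <= 2^-1 -> - (2 * `|x|) <= ln (1 - x).
Proof.
move=> x2; have x0 : 0 < 1 - x by lra.
rewrite -lerN2 -lnV ?posrE// opprK.
have -> : (1 - x)^-1 = 1 + x / (1 - x) by field; rewrite gt_eqF.
apply: le_trans (_ : x / (1 - x) <= _).
  apply: le_ln1Dx; rewrite ltr_pdivlMr//; lra.
rewrite ler_pdivrMr//; have := ler_norm x; have := normr_ge0 x; nra.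
Qed.

Lemma sqmod_add_le2 (z w : plane R) : sqmod (z + w) <= 2 * sqmod z + 2 * sqmod w.
Proof.
rewrite -subr_ge0 (_ : _ - _ = sqmod (z - w)) ?sqmod_ge0//.
rewrite /sqmod/=; ring.
Qed.

(* With s = e + |w|^2 and q = r^2 |v|^2, the product of the four values of
   e + |w|^2 is at least (s^2 - q^2)^2, and at most (s^2 + q^2)^2 if e = 0. *)
Lemma diff2_ln_sqmod e m v r (p : plane2 R) : 0 <= e -> 0 < m ->
  m <= e + sqmod p.1 -> 2 * (r ^+ 2 * sqmod v.1) <= m ->
  let D := diff2 v (fun p => ln (e + sqmod p.1)) r p in
  let b := 4 * (sqmod v.1 / m) ^+ 2 * r ^+ 4 in
  - b <= D /\ (e = 0 -> D <= b).
Proof.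
move=> e0 m0 ms qm; case: p v ms qm => [[x y] zt] [[a d] ef].
have sE (k1 k2 : R) : k1 *: k2 = k1 * k2 by [].
rewrite /diff2/=; set s := e + sqmod (x, y); set X := sqmod (a, d).
set q := r ^+ 2 * X => ms qm.
have s0 : 0 < s by exact: lt_le_trans ms.
have q0 : 0 <= q by rewrite mulr_ge0 ?sqr_ge0 ?sqmod_ge0.
pose al := 2 * r * (x * a + y * d); pose be := 2 * r * (y * a - x * d).
have -> : sqmod ((x, y) + (r *: (a, d))) = s + q + al - e.
  by rewrite /s/q/al/X/sqmod/= !sE; ring.
have -> : sqmod ((x, y) - (r *: (a, d))) = s + q - al - e.
  by rewrite /s/q/al/X/sqmod/= !sE; ring.
have -> : sqmod ((x, y) + (r *: mulI (a, d))) = s + q + be - e.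
  by rewrite /s/q/be/X/mulI/sqmod/= !sE; ring.
have -> : sqmod ((x, y) - (r *: mulI (a, d))) = s + q - be - e.
  by rewrite /s/q/be/X/mulI/sqmod/= !sE; ring.
have eK k : e + (k - e) = k by ring.
rewrite !eK.
have abE : al ^+ 2 + be ^+ 2 = 4 * q * (s - e).
  by rewrite /al /be /q /X /s /sqmod/=; ring.
have al2 : al ^+ 2 <= 4 * q * (s - e) by rewrite -abE lerDl sqr_ge0.
have be2 : be ^+ 2 <= 4 * q * (s - e) by rewrite -abE lerDr sqr_ge0.
have qs : 2 * q <= s by exact: le_trans ms.
have key (k : R) : k ^+ 2 <= 4 * q * (s - e) -> 0 < s + q + k /\ 0 < s + q - k.
  move=> k2; have : `|k| < s + q.
    have sq0 : 0 <= s + q by rewrite addr_ge0// ltW.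
    rewrite -(@ltr_pXn2r _ 2 isT) ?nnegrE//.
    rewrite real_normK ?num_real//.
    apply: le_lt_trans k2 _; rewrite -subr_gt0.
    have -> : (s + q) ^+ 2 - 4 * q * (s - e) = (s - q) ^+ 2 + 4 * (q * e) by ring.
    apply: ltr_wpDr; first by rewrite mulr_ge0// mulr_ge0.
    by rewrite exprn_gt0// subr_gt0; lra.
  by rewrite ltr_norml => /andP[? ?]; split; lra.
have [a1 a2] := key _ al2; have [b1 b2] := key _ be2.
set P := (s + q + al) * (s + q - al) * ((s + q + be) * (s + q - be)).
have lnP : ln (s + q + al) + ln (s + q - al) + ln (s + q + be) + ln (s + q - be) = ln P.
  by rewrite /P !lnM ?posrE ?mulr_gt0// !addrA.
rewrite lnP.
(* Expand ((s+q)^2 - al^2)((s+q)^2 - be^2) and eliminate al^2 + be^2 with [abE]; the two extra terms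
   are nonnegative. *)
have PE : P = (s ^+ 2 - q ^+ 2) ^+ 2 + 4 * q * e * (s + q) ^+ 2 + al ^+ 2 * be ^+ 2.
  have -> : be ^+ 2 = 4 * q * (s - e) - al ^+ 2 by rewrite -abE; ring.
  have -> : P = ((s + q) ^+ 2 - al ^+ 2) * ((s + q) ^+ 2 - be ^+ 2) by rewrite /P; ring.
  have -> : be ^+ 2 = 4 * q * (s - e) - al ^+ 2 by rewrite -abE; ring.
  ring.
pose x2 := (q / s) ^+ 2.
have x2le : x2 <= (X / m) ^+ 2 * r ^+ 4.
  have -> : (X / m) ^+ 2 * r ^+ 4 = (q / m) ^+ 2 by rewrite /q !exprMn; ring.
  rewrite /x2 lerXn2r ?nnegrE ?divr_ge0// ?(ltW s0) ?(ltW m0)//.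
  by rewrite ler_wpM2l// lef_pV2 ?posrE.
have x20 : 0 <= x2 by exact: sqr_ge0.
have x21 : x2 <= 4^-1.
  have : q / s <= 2^-1 by rewrite ler_pdivrMr//; lra.
  have : 0 <= q / s by rewrite divr_ge0// ltW.
  rewrite /x2; nra.
have s4 : ln s *+ 4 = ln (s ^+ 4) by rewrite lnXn.
have s4' : 4 * ln s = ln (s ^+ 4) by rewrite -s4 mulr_natl.
have E1 : (s ^+ 2 - q ^+ 2) ^+ 2 = s ^+ 4 * (1 - x2) ^+ 2.
  by rewrite /x2; field; rewrite gt_eqF.
have E2 : (s ^+ 2 + q ^+ 2) ^+ 2 = s ^+ 4 * (1 + x2) ^+ 2.
  by rewrite /x2; field; rewrite gt_eqF.
have P0 : 0 < P by rewrite !mulr_gt0.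
rewrite s4'; split.
  apply: (@le_trans _ _ (2 * ln (1 - x2))).
    have h : x2 <= 2^-1 by lra.
    by have := ln1B_ge h; rewrite ger0_norm//; lra.
  rewrite lerBrDr mulr_natl -lnXn; last lra.
  rewrite addrC -lnM ?posrE ?exprn_gt0//; last lra.
  rewrite -E1 ler_ln ?posrE//; last by rewrite E1 mulr_gt0// exprn_gt0//; lra.
  rewrite PE -addrA lerDl; apply: addr_ge0; apply: mulr_ge0; rewrite ?sqr_ge0//.
  by apply: mulr_ge0 => //; apply: mulr_ge0.
move=> e00; apply: (@le_trans _ _ (2 * ln (1 + x2))); last first.
  have h : ln (1 + x2) <= x2 by apply: le_ln1Dx; lra.
  lra.
rewrite lerBlDr mulr_natl -lnXn; last lra.
rewrite addrC -lnM ?posrE ?exprn_gt0//; last lra.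
rewrite -E2 ler_ln ?posrE//; last by rewrite E2 mulr_gt0// exprn_gt0//; lra.
rewrite PE e00 mulr0 mul0r addr0.
(* AM-GM bounds al^2 be^2 by (4qs)^2/4 = 4q^2s^2, which is exactly what turns (s^2 - q^2)^2 into
   (s^2 + q^2)^2. *)
have h : 4 * (al ^+ 2 * be ^+ 2) <= (al ^+ 2 + be ^+ 2) ^+ 2.
  by rewrite -subr_ge0 (_ : _ - _ = (al ^+ 2 - be ^+ 2) ^+ 2) ?sqr_ge0//; ring.
move: h; rewrite abE e00 subr0.
have -> : (s ^+ 2 + q ^+ 2) ^+ 2 = (s ^+ 2 - q ^+ 2) ^+ 2 + (4 * q * s) ^+ 2 / 4 by field.
by move=> h; rewrite lerD2l ler_pdivlMr// mulrC.
Qed.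

(** [weak_laplacian_ge0] asks for a bounded function on all of C^2. Clipping at [m] and [M] yields
    one; the margin 4m on [K] keeps all points of [diff2] in the unclipped range for [r < r0]. *)
Lemma ln_sqmod_clip K e m c v : compact K -> 0 <= e -> 0 < m ->
  (forall p, K p -> 4 * m <= e + sqmod p.1) ->
  exists u C r0, [/\ measurable_fun setT (u : T4 -> R) /\ (exists B, forall p, `|u p| <= B),
    forall p, K p -> u p = ln (e + sqmod p.1) + c, 0 < r0 &
    forall r p, K p -> 0 < r -> r < r0 -> - (C * r ^+ 4) <= diff2 v u r p /\
      (e = 0 -> diff2 v u r p <= C * r ^+ 4)].
Proof.
move=> cK e0 m0 Km; have [M0 KM0] := compact_sub_box cK.
pose M := e + 4 * M0 ^+ 2 + 4 * m.
have mM : m < M by rewrite /M; have := sqr_ge0 M0; lra.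
have sM p : K p -> sqmod p.1 <= 2 * M0 ^+ 2.
  move=> /KM0 [[]]; rewrite /sqmod/= !in_itv/= -!ler_norml => h1 h2 _.
  rewrite mulr_natl mulr2n lerD// -real_normK ?num_real// lerXn2r ?nnegrE//.
    exact: le_trans h1.
  exact: le_trans h1.
pose clip p := Num.max m (Num.min M (e + sqmod (p : plane2 R).1)).
have clipm p : m <= clip p by rewrite le_max lexx.
have clipM p : clip p <= M by rewrite ge_max (ltW mM) ge_min lexx.
have clipE p : m <= e + sqmod p.1 -> e + sqmod p.1 <= M -> clip p = e + sqmod p.1.
  by move=> h1 h2; rewrite /clip min_r// max_r.
pose u p := ln (clip p) + c.
pose X := sqmod v.1.
have X0 : 0 <= X by exact: sqmod_ge0.
(* The choice of [r0] gives 2 r^2 X <= m, the smallness that [diff2_ln_sqmod] requires. *)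
exists u, (4 * (X / m) ^+ 2), (Num.min 1 (m / (2 * (1 + X)))); split.
- split.
    apply: continuous_measurable4 => p.
    apply: (@continuousD _ _ _ (fun p => ln (clip p)) (fun=> c)); last exact: cst_continuous.
    apply: (@continuous_comp _ _ _ clip (@ln R)); last first.
      by apply: continuous_ln; exact: lt_le_trans (clipm p).
    apply: (@continuous_max _ _ (fun=> m) (fun p => Num.min M (e + sqmod p.1)));
      first exact: cst_continuous.
    apply: (@continuous_min _ _ (fun=> M) (fun p => e + sqmod p.1));
      first exact: cst_continuous.
    apply: (@continuousD _ _ _ (fun=> e) (fun p => sqmod p.1)); first exact: cst_continuous.
    apply: (@continuous_comp _ _ _ fst (@sqmod R)); first exact: cvg_fst.
    exact: continuous_sqmod.
  exists (`|ln m| + `|ln M| + `|c|) => p.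
  rewrite (le_trans (ler_normD _ _))// lerD2r.
  have h1 : ln m <= ln (clip p) by rewrite ler_ln ?posrE// (lt_le_trans m0).
  have h2 : ln (clip p) <= ln M.
    by rewrite ler_ln ?posrE//; [exact: lt_le_trans (clipm p)|exact: lt_trans mM].
  rewrite ler_norml; have := ler_norm (ln M); have := ler_norm (- ln m).
  rewrite normrN; have := normr_ge0 (ln m); have := normr_ge0 (ln M).
  by move=> ? ? ? ?; apply/andP; split; lra.
- move=> p Kp; rewrite /u clipE//; first by apply: le_trans (Km p Kp); lra.
  by rewrite /M; have := sM p Kp; have := sqr_ge0 M0; lra.
- by rewrite lt_min ltr01 divr_gt0//; lra.
move=> r p Kp r0; rewrite lt_min => /andP[r1 rm].
have q1 : 2 * (r ^+ 2 * X) <= m.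
  rewrite expr2 -mulrA; move: rm; rewrite ltr_pdivlMr; last lra.
  have : 0 <= r * X by rewrite mulr_ge0// ltW.
  nra.
have near w : sqmod w = r ^+ 2 * X ->
    m <= e + sqmod (p.1 + w) /\ e + sqmod (p.1 + w) <= M.
  move=> wE; have h1 := sqmod_add_le2 p.1 w.
  have h2 := sqmod_add_le2 (p.1 + w) (- w); rewrite addrK in h2.
  have Nw : sqmod (- w) = sqmod w by rewrite /sqmod/= !sqrrN.
  rewrite Nw in h2; have h3 := sM p Kp; have h4 := Km p Kp.
  by rewrite /M; split; lra.
have mIX : sqmod (mulI v.1) = X by rewrite /sqmod/= sqrrN addrC.
have Nw (w : plane R) : sqmod (- w) = sqmod w by rewrite /sqmod/= !sqrrN.
have := @diff2_ln_sqmod e m v r p e0 m0.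
have h4 := Km p Kp.
have E : diff2 v u r p = diff2 v (fun p => ln (e + sqmod p.1)) r p.
  rewrite /diff2 /u !clipE; [ring|..]; rewrite -?[(p + _).1]/(p.1 + _).
  all: try by [exact: (near _ (sqmodZ _ _)).1|exact: (near _ (sqmodZ _ _)).2|
    apply: (near _ _).1; rewrite Nw; exact: sqmodZ|
    apply: (near _ _).2; rewrite Nw; exact: sqmodZ].
  all: try by [apply: (near _ _).1; rewrite sqmodZ mIX|
    apply: (near _ _).2; rewrite sqmodZ mIX|
    apply: (near _ _).1; rewrite Nw sqmodZ mIX|
    apply: (near _ _).2; rewrite Nw sqmodZ mIX].
  + by lra.
  + by rewrite /M; have := sM p Kp; have := sqr_ge0 M0; lra.
by rewrite E; apply => //; lra.
Qed.


Lemma bounded_integrable_compact (u : plane2 R -> R) K : compact K ->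
  measurable_fun setT (u : T4 -> R) -> (exists B, forall p, `|u p| <= B) ->
  mu.-integrable K (EFin \o (u : T4 -> R)).
Proof.
move=> cK mfu [B uB]; have mK := compact_measurable4 cK.
have [M KM] := compact_sub_box cK.
have I : mu.-integrable setT (EFin \o (fun p : T4 => u p * \1_K p)).
  apply: bounded_support_integrable; apply: bounded_supportM => //; first by exists B.
  split; first exact: measurable_indic.
  exists M, 1 => p; rewrite indicE; split; first by case: (_ \in _); rewrite ?normr0 ?normr1.
  by move=> pM; rewrite memNset// => /KM.
apply: (eq_integrable mK (EFin \o (fun p : T4 => u p * \1_K p))).
  by move=> p pK /=; rewrite indicE pK mulr1.
exact: integrableS measurableT mK (@subsetT _ _) I.
Qed.

Lemma ddc_currentE U (f : plane2 R -> \bar R) (u chi : plane2 R -> R) K v :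
  compact K -> K `<=` U -> (forall p, ~ K p -> chi p = 0) ->
  (forall p, K p -> f p = (u p)%:E) ->
  bounded_support (fun p => u p * laplacian v chi p) ->
  ddc_current U f v chi =
    ((4 * pi)^-1 * \int[mu]_p (u p * laplacian v chi p))%:E.
Proof.
move=> cK KU chiK fu bs.
have off w p : ~ K p -> 'D_w (fun y => 'D_w chi y) p = 0.
  by apply: derive_off_compact => // q; exact: derive_off_compact.
have loff p : ~ K p -> laplacian v chi p = 0 
  by move=> Kp; have := congr2 +%R (off v p Kp) (off (mulI2 v) p Kp); rewrite [0 + 0]addr0; exact.
rewrite /ddc_current integral_mkcond.
transitivity (\int[mu]_p ((4 * pi)^-1 * (u p * laplacian v chi p))%:E)%E.
  apply: eq_integral => p _; rewrite /patch.
  have [Kp|Kp] := pselect (K p).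
    by rewrite mem_set ?fu//; [rewrite -EFinM /ddc mulrCA|exact: KU].
  by rewrite /ddc -/(laplacian v chi p) loff// !mulr0 mule0; case: ifP.
rewrite -[RHS]fineK//= -RintegralZl ?fineK//.
  exact: integrable_fin_num (bounded_support_integrable (bounded_support_cst _ bs)).
exact: bounded_support_integrable.
Qed.

Lemma current_ge0_ln U (f : plane2 R -> \bar R) e c : 0 < e ->
  (forall p, U p -> f p = (ln (e + sqmod p.1) + c)%:E) -> current_ge0 U f.
Proof.
move=> e0 fE.
have em : 0 < e / 4 by rewrite divr_gt0.
have ge p : 4 * (e / 4) <= e + sqmod (p : plane2 R).1.
  by rewrite mulrC divfK// lerDl sqmod_ge0.
split.
  move=> K cK KU.
  have [u [C [r0 [[mfu uB] uE _ _]]]] := ln_sqmod_clip c 0 cK (ltW e0) em (fun p _ => ge p).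
  apply: (eq_integrable (compact_measurable4 cK) (EFin \o (u : T4 -> R))).
    by move=> p /set_mem Kp; rewrite /= fE ?uE//; exact: KU.
  exact: bounded_integrable_compact.
move=> v chi [schi [K [cK KU chiK]]] chi0.
have [u [C [r0 [[mfu uB] uE r00 uD]]]] := ln_sqmod_clip c v cK (ltW e0) em (fun p _ => ge p).
have [_ [M [B chiB]]] := continuous_bounded_support (Ck_continuous (schi 0)) cK chiK.
have [|bs I] := @weak_laplacian_ge0 R u chi K v (`|C| * B) r0 mfu uB (schi 2) cK chiK r00.
  move=> r p r1 rr0; have [Kp|Kp] := pselect (K p); last first.
    by rewrite chiK// mulr0 oppr_le0 mulr_ge0 ?exprn_ge0 ?(ltW r1)// mulr_ge0// (le_trans _ (chiB p).1).
  have [uC _] := uD r p Kp r1 rr0.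
  apply: (@le_trans _ _ (- (C * r ^+ 4) * chi p)); last by rewrite ler_wpM2r.
  rewrite mulNr lerN2 mulrAC; apply: ler_wpM2r; first by rewrite exprn_ge0// ltW.
  apply: le_trans (ler_wpM2r (chi0 p) (ler_norm C)) _.
  by apply: ler_wpM2l => //; apply: le_trans (ler_norm _) (chiB p).1.
have fu p : K p -> f p = (u p)%:E by move=> Kp; rewrite fE ?uE//; exact: KU.
rewrite (ddc_currentE cK KU chiK fu bs) lee_fin mulr_ge0//.
by rewrite invr_ge0 mulr_ge0// pi_ge0.
Qed.

(** ln |w|^2 is pluriharmonic away from w = 0: for e = 0 the second-difference estimate is
    two-sided, so positivity holds for both [u] and [- u]. *)
Lemma current_eq0_ln U (f : plane2 R -> \bar R) m : 0 < m ->
  (forall p, U p -> 4 * m <= sqmod p.1) ->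
  (forall p, U p -> f p = (ln (sqmod p.1))%:E) -> current_eq0 U f.
Proof.
move=> m0 Um fE; have Um' p : U p -> 4 * m <= 0 + sqmod p.1 by rewrite add0r; exact: Um.
have uE' (u : plane2 R -> R) K : K `<=` U ->
    (forall p, K p -> u p = ln (0 + sqmod p.1) + 0) -> forall p, K p -> f p = (u p)%:E.
  by move=> KU uE p Kp; rewrite uE// add0r addr0 fE//; exact: KU.
split.
  move=> K cK KU.
  have [u [C [r0 [[mfu uB] /(uE' _ _ KU) fu _ _]]]] :=
    ln_sqmod_clip 0 0 cK (lexx 0) m0 (fun p Kp => Um' p (KU p Kp)).
  apply: (eq_integrable (compact_measurable4 cK) (EFin \o (u : T4 -> R))).
    by move=> p /set_mem Kp; rewrite /= fu.
  exact: bounded_integrable_compact.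
move=> v chi [schi [K [cK KU chiK]]].
have [u [C [r0 [[mfu uB] /(uE' _ _ KU) fu r00 uD]]]] :=
  ln_sqmod_clip 0 v cK (lexx 0) m0 (fun p Kp => Um' p (KU p Kp)).
have [_ [M [B chiB]]] := continuous_bounded_support (Ck_continuous (schi 0)) cK chiK.
have Dle r p : 0 < r -> r < r0 -> `|diff2 v u r p * chi p| <= `|C| * B * r ^+ 4.
  move=> r1 rr0; have [Kp|Kp] := pselect (K p); last first.
    by rewrite chiK// mulr0 normr0 mulr_ge0 ?exprn_ge0 ?(ltW r1)// mulr_ge0// (le_trans _ (chiB p).1).
  have [h1 h2] := uD r p Kp r1 rr0.
  rewrite normrM mulrAC; apply: ler_pM => //; last exact: (chiB p).1.
  apply: (@le_trans _ _ (C * r ^+ 4)); first by rewrite ler_norml h1 h2.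
  by rewrite ler_wpM2r ?ler_norm// exprn_ge0// ltW.
have [|bs I] := @weak_laplacian_ge0 R u chi K v (`|C| * B) r0 mfu uB (schi 2) cK chiK r00.
  by move=> r p r1 rr0; have := Dle r p r1 rr0; rewrite ler_norml => /andP[].
have uNB : exists B0, forall p, `|- u p| <= B0.
  by have [B0 hB0] := uB; exists B0 => p; rewrite normrN.
have mNu : measurable_fun setT ((fun p => - u p) : T4 -> R) by exact: measurableT_comp.
have [|_ I'] := @weak_laplacian_ge0 R (fun p => - u p) chi K v (`|C| * B) r0 mNu uNB (schi 2) cK chiK r00.
  move=> r p r1 rr0; have := Dle r p r1 rr0; rewrite ler_norml => /andP[_].
  have -> : diff2 v (fun p => - u p) r p = - diff2 v u r p by rewrite /diff2; ring.
  by rewrite mulNr lerN2.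
rewrite (ddc_currentE cK KU chiK fu bs); congr (_%:E); apply/eqP.
rewrite mulf_eq0; apply/orP; right; rewrite eq_le I andbT.
move: I'; under eq_Rintegral do rewrite mulNr.
rewrite (_ : \int[mu]_p - (u p * laplacian v chi p) =
  \int[mu]_p (-1 * (u p * laplacian v chi p))); last first.
  by apply: eq_Rintegral => p _; rewrite mulN1r.
by rewrite RintegralZl// ?mulN1r ?oppr_ge0//; exact: bounded_support_integrable.
Qed.

Lemma current_eq0_cst0 U (f : plane2 R -> \bar R) :
  (forall p, U p -> f p = 0%E) -> current_eq0 U f.
Proof.
move=> f0; split=> [K cK KU|v chi _].
  apply: (eq_integrable (compact_measurable4 cK) (cst 0%E)).
    by move=> p /set_mem /KU /f0 ->.
  exact: integrable0.
by apply: integral0_eq => p Up; rewrite f0// mul0e.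
Qed.

End ln_current.

(** * The envelope *)

Section lower_competitor.
Context {R : realType}.
Notation mu := (@lebesgue_measure R).
Implicit Types (e : R) (v w tau : plane R).

(** The value at infinity is the limit of the other branch, which makes the function continuous on
    the sphere. *)
Definition round_pot e (z : P1 R) : R :=
  if z is Some v then ln ((1 + e * sqmod v) / (1 + 2 * e)) - fs_pot v
  else ln (e / (1 + 2 * e)).

Definition lower e (p : P1 R * plane R) : \bar R := (round_pot e p.1)%:E.

(** In both charts the local potential is ln (k + |w|^2) plus a constant with k > 0, so a single
    function carries both plurisubharmonicity conditions on a competitor. *)
Lemma twist_lower e j p : 0 < e -> twist (lower e) j p =
  (ln ((if j then e else e^-1) + sqmod p.1) +
   (if j then - ln (1 + 2 * e) else ln (e / (1 + 2 * e))))%:E.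
Proof.
move=> e0; rewrite /twist /lower -EFinD /chart_prod /=; congr (_%:E).
have d0 : 0 < 1 + 2 * e by lra.
have s0 := sqmod_ge0 p.1; case: j => /=; last first.
  rewrite addrC subrK -lnM ?posrE ?divr_gt0// ?ltr_wpDr ?invr_gt0//.
  by congr ln; field; rewrite !gt_eqF.
case: eqVneq => [->|w0] /=.
  rewrite /fs_pot /sqmod/= expr0n/= !addr0 ln1 add0r.
  by rewrite lnM ?posrE ?invr_gt0// lnV ?posrE.
have sp : 0 < sqmod p.1 by rewrite sqmod_gt0.
have i0 : 0 < (sqmod p.1)^-1 by rewrite invr_gt0.
have ei : 0 < e * (sqmod p.1)^-1 by rewrite mulr_gt0.
have n0 : 0 < (1 + e / sqmod p.1) / (1 + 2 * e) by rewrite divr_gt0// addr_gt0.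
have c0 : 0 < 1 + (sqmod p.1)^-1 by rewrite addr_gt0.
have t0 : 0 < 1 + sqmod p.1 by rewrite addr_gt0.
have es0 : 0 < e + sqmod p.1 by rewrite addr_gt0.
have tn0 := mulr_gt0 t0 n0.
rewrite /fs_pot sqmod_cinv addrA -lnM ?posrE// -!ln_div ?posrE//.
congr ln; field; rewrite !gt_eqF//; lra.
Qed.

Lemma round_pot_near_infty e (a : R) : 0 < e -> e <= 1 -> ln (e / (1 + 2 * e)) < a ->
  exists M, forall v, M < sqmod v -> round_pot e (Some v) < a.
Proof.
move=> e0 e1 ha; have d0 : 0 < 1 + 2 * e by lra.
pose d := expR a - e / (1 + 2 * e).
have dp : 0 < d by rewrite subr_gt0 -[ltLHS]lnK ?ltr_expR// posrE divr_gt0.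
exists d^-1 => v vM.
have s0 : 0 < sqmod v by apply: lt_trans vM; rewrite invr_gt0.
have es : 0 < e * sqmod v by rewrite mulr_gt0.
have n0 : 0 < (1 + e * sqmod v) / (1 + 2 * e) by rewrite divr_gt0//; lra.
have t0 : 0 < 1 + sqmod v by lra.
rewrite /= /fs_pot -ln_div ?posrE// -[ltRHS]expRK ltr_ln ?posrE ?expR_gt0//; last exact: divr_gt0.
have -> : expR a = d + e / (1 + 2 * e) by rewrite /d subrK.
(* Split off the value at infinity; the remainder is at most 1/(1 + |v|^2). *)
have -> : (1 + e * sqmod v) / (1 + 2 * e) / (1 + sqmod v) =
    (1 - e) / (1 + 2 * e) / (1 + sqmod v) + e / (1 + 2 * e).
  by field; rewrite !gt_eqF.
rewrite ltrD2r; apply: (@le_lt_trans _ _ (1 + sqmod v)^-1).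
  rewrite ler_piMl// ?invr_ge0 ?(ltW t0)// ler_pdivrMr//; lra.
by rewrite invf_plt ?posrE//; lra.
Qed.

Lemma continuous_round_pot e : 0 < e ->
  continuous (fun v : plane R => round_pot e (Some v)).
Proof.
move=> e0; have d0 : 0 < 1 + 2 * e by lra.
have cl (k c : R) : 0 < k -> 0 <= c ->
    continuous (fun v : plane R => ln ((k + c * sqmod v))).
  move=> k0 c0 v; apply: (@continuous_comp _ _ _ (fun v : plane R => k + c * sqmod v) (@ln R)).
    apply: (@continuousD _ _ _ (fun=> k) (fun v : plane R => c * sqmod v)).
      exact: cst_continuous.
    by apply: continuousM; [exact: cst_continuous|exact: continuous_sqmod].
  by apply: continuous_ln; rewrite ltr_pwDl// mulr_ge0 ?sqmod_ge0.
rewrite (_ : (fun v => _) = fun v : plane R =>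
    ln ((1 + 2 * e)^-1 + e / (1 + 2 * e) * sqmod v) - ln (1 + 1 * sqmod v)); last first.
  apply/funext => v; rewrite /= /fs_pot mul1r; congr (ln _ - _).
  by field; rewrite gt_eqF.
move=> v; apply: (@continuousB _ _ _ (fun v : plane R =>
    ln ((1 + 2 * e)^-1 + e / (1 + 2 * e) * sqmod v)) (fun v => ln (1 + 1 * sqmod v))).
  by apply: cl; rewrite ?invr_gt0// divr_ge0// ltW.
exact: cl.
Qed.

Lemma usc_on_lower e (A : set (P1 R * plane R)) : 0 < e -> e <= 1 -> usc_on A (lower e).
Proof.
move=> e0 e1 [z tau] _ a; rewrite /lower/= lte_fin => za.
apply: (@cvg_within _ (nbhs (z, tau))).
have : \forall y \near z, round_pot e y < a.
  case: z za => [v|] /= za.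
    exact: (@cvgr_lt _ _ _ _ _ _ (@continuous_round_pot e e0 v) _ za).
  have [M hM] := round_pot_near_infty e0 e1 za.
  exists [set v | sqmod v <= M].
    split; first exact: compact_sqmod_le.
    rewrite (_ : [set v : plane R | _] = @sqmod R @^-1` [set t | t <= M])//.
    by apply: preimage_closed; [move=> w _; exact: continuous_sqmod|exact: closed_le].
  move=> _ [[v /= /negP vM <-]|->//]; apply: hM; by rewrite ltNge.
move=> h; have : \forall p \near (z, tau), round_pot e p.1 < a.
  exact: (cvg_fst h).
by apply: filterS => p; rewrite lte_fin.
Qed.

Lemma sub_mean_value_ln_sqmod (U : set (plane2 R)) (f : plane2 R -> \bar R) e (c : R) :
  0 < e -> (forall p, f p = (ln (e + sqmod p.1) + c)%:E) -> sub_mean_value U f.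
Proof.
move=> e0 fE x v _; have [h ch] := ln_sqmod_mean x.1 v.1 e0.
have cch : continuous (fun t : R =>
    ln (e + sqmod (x.1 + (cos t *: v.1 + sin t *: mulI v.1))) + c).
  move=> t; apply: (@continuousD _ _ _
    (fun t : R => ln (e + sqmod (x.1 + (cos t *: v.1 + sin t *: mulI v.1)))) (fun=> c)).
    exact: ch.
  exact: cst_continuous.
under eq_integral do rewrite fE.
rewrite fE -[X in (_ * X)%E]fineK; last first.
  exact: integrable_fin_num (continuous_itv_integrable 0 (2 * pi) cch).
have -> : fine (\int[mu]_(t in `[0%R, (2 * pi)%R])
    (ln (e + sqmod (x.1 + (cos t *: v.1 + sin t *: mulI v.1))) + c)%:E)%E =
  \int[mu]_(t in `[0, 2 * pi])
    (ln (e + sqmod (x.1 + (cos t *: v.1 + sin t *: mulI v.1))) + c) by [].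
have p0 : 0 < 2 * pi :> R by rewrite mulr_gt0// pi_gt0.
rewrite (@RintegralD _ _ _ mu _
  (fun t => ln (e + sqmod (x.1 + (cos t *: v.1 + sin t *: mulI v.1)))) (fun=> c))//.
- rewrite Rintegral_cst//.
  have mE := @lebesgue_measure_itv R `[0, 2 * pi].
  rewrite /= lte_fin p0 in mE.
  have -> : fine (mu `[0, 2 * pi]%classic) = 2 * pi.
    by transitivity (fine ((2 * pi : R) - 0)%:E); [congr fine; exact: mE|rewrite /= subr0].
  set X := \int[mu]_(t in _) _ in h *.
  rewrite -EFinM lee_fin (_ : _ * (X + _) = (2 * pi)^-1 * X + c); last first.
    by rewrite mulrDr [_ * (c * _)]mulrCA mulVf ?mulr1// gt_eqF.
  by rewrite lerD2r ler_pdivlMl.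
- exact: continuous_itv_integrable.
- apply: continuous_itv_integrable => t; exact: cst_continuous.
Qed.

Lemma expRN1_le : expR (- 1) <= 2^-1 :> R.
Proof.
rewrite expRN lef_pV2 ?posrE ?expR_gt0//; apply: le_trans (expR_ge1Dx _); lra.
Qed.

(** For |v|^2 <= 2 the denominator 1 + 2e makes the left side at most 0. Beyond that [flat 0] is at
    least e^(-1), so [th_z] at s = |v|^2 is at least 1 + s e^(-1)/4, whence the bound imposed on
    [e]. *)
Lemma lower_le_fch e t v : circle t -> 0 < e -> e <= expR (- 1) / 4 ->
  ln ((1 + e * sqmod v) / (1 + 2 * e)) <= fch false t v.
Proof.
move=> ct e0 ele; have s0 := sqmod_ge0 v; have d0 : 0 < 1 + 2 * e by lra.
have /andP[q0 _] := quad_ge0_le v ct.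
apply: (@le_trans _ _ (ln (th_z (sqmod v)))); last first.
  rewrite /fch /pot lerDl divr_ge0 ?sqr_ge0// divr_ge0//.
rewrite ler_ln ?posrE ?th_z_gt0// ?divr_gt0//; last by rewrite ltr_pwDl// mulr_ge0// ltW.
rewrite ler_pdivrMr//; set s := sqmod v in s0 *.
have [s2|s2] := leP s 2.
  apply: (@le_trans _ _ (1 * (1 + 2 * e))).
    by rewrite mul1r lerD2l mulrC ler_wpM2r// ltW.
  by rewrite ler_wpM2r ?(ltW d0)// /th_z lerDl divr_ge0// mulr_ge0// flat_ge0.
have h1 : expR (- 1) <= flat 0 (s - 1).
  rewrite flat0_gt0E; last lra.
  rewrite ler_expR lerN2 invf_le1; lra.
have h2 : s * e <= s * flat 0 (s - 1) / 4.
  by rewrite -mulrA; apply: ler_wpM2l => //; lra.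
have h3 : 0 <= s * flat 0 (s - 1) / 4 by rewrite divr_ge0// mulr_ge0// flat_ge0.
rewrite /th_z; nra.
Qed.

Lemma competitor_lower e : 0 < e -> e <= expR (- 1) / 4 -> competitor (@phi R) (lower e).
Proof.
move=> e0 ele; have e1 : e <= 1 by have := expRN1_le; lra.
have k0 j : 0 < if j then e else e^-1 by case: j; rewrite ?invr_gt0.
split.
- by move=> p _; rewrite ltry.
- exact: usc_on_lower.
- by move=> j; apply: (current_ge0_ln (k0 j)) => p _; exact: twist_lower.
- by move=> j; apply: (sub_mean_value_ln_sqmod (k0 j)) => p; exact: twist_lower.
move=> z tau ct; rewrite lee_fin /lower/=.
case: z => [v|] /=; first by rewrite lerD2r; exact: lower_le_fch.
have -> : fs_pot (0 : plane R) = 0 by rewrite /fs_pot /sqmod/= expr0n/= !addr0 ln1.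
rewrite subr0 /pot /th_w /quad /sqmod/= expr0n/= !(mulr0, mul0r, addr0, subr0, add0r, oppr0).
(* At infinity the claim is e/(1 + 2e) <= 1/4, the value of [th_w] at 0. *)
rewrite flat0_gt0E// invr1 -expRD subrr expR0.
rewrite ler_ln ?posrE ?divr_gt0//; last lra.
rewrite ler_pdivrMr; last lra.
have := expRN1_le; lra.
Qed.

End lower_competitor.

(** * Holomorphic discs and the value of the envelope *)

Section envelope.
Context {R : realType}.
Implicit Types (b v w tau : plane R).

(* [b + conj b * tau]: the graph of this function of [tau] is the leaf through
   the centre [b]. *)
Definition leaf b tau : plane R :=
  (b.1 + b.1 * tau.1 + b.2 * tau.2, b.2 + b.1 * tau.2 - b.2 * tau.1).

(** For |tau| = 1 the point v = b + conj(b) tau satisfies v = tau conj(v), hence conj(tau) v^2 =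
    |v|^2. *)
Lemma quad_leaf b tau : circle tau -> quad tau (leaf b tau) = 0.
Proof.
rewrite /circle /quad /sqmod/= => ct.
have c2 : tau.2 ^+ 2 = 1 - tau.1 ^+ 2 by rewrite -ct addrAC subrr add0r.
have c3 : tau.2 ^+ 3 = tau.2 * (1 - tau.1 ^+ 2) by rewrite exprS c2.
apply/eqP; rewrite mulf_eq0; apply/orP; left; apply/eqP; ring: c2 c3.
Qed.

Lemma sqmod_leaf b tau : sqmod tau <= 1 -> sqmod (leaf b tau) <= 4 * sqmod b.
Proof.
move=> t1; have := sqmod_add_le2 b (leaf b tau - b); rewrite addrC subrK.
have -> : sqmod (leaf b tau - b) = sqmod b * sqmod tau by rewrite /sqmod/leaf/=; ring.
have := ler_wpM2l (sqmod_ge0 b) t1; lra.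
Qed.

Lemma continuous_leaf b : continuous (leaf b).
Proof.
move=> tau; apply: (@cvg_pair _ _ _ (nbhs tau) (nbhs (leaf b tau).1) (nbhs (leaf b tau).2)
  _ _ _ (fun t => b.1 + b.1 * t.1 + b.2 * t.2) (fun t => b.2 + b.1 * t.2 - b.2 * t.1)).
  apply: (@continuousD _ _ _ (fun t : plane R => b.1 + b.1 * t.1) (fun t => b.2 * t.2)).
    apply: (@continuousD _ _ _ (fun=> b.1) (fun t : plane R => b.1 * t.1)).
      exact: cst_continuous.
    by apply: continuousM; [exact: cst_continuous|exact: cvg_fst].
  by apply: continuousM; [exact: cst_continuous|exact: cvg_snd].
apply: (@continuousB _ _ _ (fun t : plane R => b.2 + b.1 * t.2) (fun t => b.2 * t.1)).
  apply: (@continuousD _ _ _ (fun=> b.2) (fun t : plane R => b.1 * t.2)).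
    exact: cst_continuous.
  by apply: continuousM; [exact: cst_continuous|exact: cvg_snd].
by apply: continuousM; [exact: cst_continuous|exact: cvg_fst].
Qed.

(** The bound on [b] keeps the leaf in the unit disc, where [th_z] is 1; with [quad_leaf] the
    boundary potential is 0 along it, and the maximum principle applies to the restriction. *)
Lemma competitor_leaf_le0 psi b tau : competitor (@phi R) psi -> sqmod b <= 4^-1 ->
  closed_disc tau -> (twist psi false (leaf b tau, tau) <= 0)%E.
Proof.
move=> [psioo upsi _ spsi psiphi] b4.
have clf : continuous (fun t => fs_pot (leaf b t)).
  move=> t; apply: (@continuous_comp _ _ _ (fun t => 1 + sqmod (leaf b t)) (@ln R)).
    apply: (@continuousD _ _ _ (fun=> 1 : R) (fun t : plane R => sqmod (leaf b t))).
      exact: cst_continuous.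
    apply: (@continuous_comp _ _ _ (leaf b) (@sqmod R)); first exact: continuous_leaf.
    exact: continuous_sqmod.
  by apply: continuous_ln; rewrite ltr_pwDl// sqmod_ge0.
have cS t : (Some (leaf b y) : P1 R, y) @[y --> t] --> (Some (leaf b t) : P1 R, t).
  apply: (@cvg_pair _ _ _ (nbhs t) (nbhs (Some (leaf b t) : P1 R)) (nbhs t) _ _ _
    (fun y => Some (leaf b y) : P1 R) id); last exact: cvg_id.
  apply: (@continuous_comp _ _ _ (leaf b) (Some : plane R -> P1 R)).
    exact: continuous_leaf.
  exact: one_point_compactification_some_continuous.
pose g0 t := psi (Some (leaf b t), t).
have ug0 : usc_on (@closed_disc R) g0.
  move=> t ct a ga; rewrite near_withinE.
  have := upsi (Some (leaf b t), t) ct a ga; rewrite near_withinE => h.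
  exact: (cS t _ h).
apply: (@disc_maximum_principle R (fun t => twist psi false (leaf b t, t))).
- rewrite (_ : (fun t => _) = fun t => (g0 t + (fs_pot (leaf b t))%:E)%E).
    by apply: usc_onD => // t ct; exact: psioo.
  by apply/funext => t; rewrite /twist addeC.
- by move=> t ct; rewrite /twist lte_add_pinfty ?ltry//; exact: psioo.
- move=> z r r0 zr.
  (* r (conj(b), 1), tangent to the leaf: the leaf is affine in tau, so a disc in the tau-plane
     lifts to a disc in a complex line. *)
  pose xi : plane2 R := ((r * b.1, - (r * b.2)), (r, 0)).
  have E (t : plane R) : (leaf b z, z) + (t.1 *: xi + t.2 *: mulI2 xi) =
      (leaf b (z + r *: t), z + r *: t).
    have sE (k1 k2 : R) : k1 *: k2 = k1 * k2 by [].
    rewrite /leaf /mulI2 /mulI /xi; case: z {zr} => z1 z2; case: t => t1 t2.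
    by congr ((_, _), (_, _)); rewrite /= !sE; ring.
  have Et (t : R) : (leaf b z, z) + (cos t *: xi + sin t *: mulI2 xi) =
      (leaf b (z + r *: expi t), z + r *: expi t) by exact: E (expi t).
  have := spsi false (leaf b z, z) xi.
  under eq_integral do rewrite Et.
  by apply => t ct; rewrite E; exact: zr.
move=> z cz; have cz1 : sqmod z <= 1 by rewrite -cz.
have s1 : sqmod (leaf b z) <= 1 by have := sqmod_leaf b cz1; lra.
have := psiphi (Some (leaf b z)) z cz => h.
rewrite /twist /chart_prod /=; apply: le_trans (leeD2l _ h) _.
rewrite -EFinD lee_fin /phi addrC subrK /fch /pot quad_leaf// /th_z flat_le0 ?subr_le0//.
by rewrite !(mulr0, mul0r) !addr0 ln1.
Qed.

(** Solving b + conj(b) tau = v with its conjugate gives b = (v - tau conj(v)) / (1 - |tau|^2); the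
    smallness assumptions leave room in |b| <= 1/2. *)
Lemma leaf_through v tau : sqmod v < 64^-1 -> sqmod tau < 4^-1 ->
  exists2 b, sqmod b <= 4^-1 & leaf b tau = v.
Proof.
move=> v8 t2; have k0 : 0 < 1 - sqmod tau by lra.
pose b : plane R := ((v.1 - (tau.1 * v.1 + tau.2 * v.2)) / (1 - sqmod tau),
  (v.2 - (tau.2 * v.1 - tau.1 * v.2)) / (1 - sqmod tau)).
exists b; last first.
  have kn : 1 - (tau.1 ^+ 2 + tau.2 ^+ 2) != 0 by rewrite -/(sqmod tau) gt_eqF.
  rewrite [RHS]surjective_pairing /leaf /b/= /sqmod.
  by congr (_, _); field.
pose w : plane R := (tau.1 * v.1 + tau.2 * v.2, tau.2 * v.1 - tau.1 * v.2).
have wE : sqmod w = sqmod tau * sqmod v by rewrite /sqmod/w/=; ring.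
have Nw : sqmod (- w) = sqmod w by rewrite /sqmod/= !sqrrN.
have -> : sqmod b = sqmod (v - w) / (1 - sqmod tau) ^+ 2.
  by rewrite {1}/sqmod/b/= !expr_div_n -mulrDl.
rewrite ler_pdivrMr ?exprn_gt0//.
have h := sqmod_add_le2 v (- w); rewrite Nw wE in h.
have h2 : sqmod tau * sqmod v <= 4^-1 * 64^-1.
  by apply: ler_pM; rewrite ?sqmod_ge0// ltW.
have h3 : (3 / 4) ^+ 2 <= (1 - sqmod tau) ^+ 2.
  by rewrite lerXn2r ?nnegrE//; lra.
lra.
Qed.

Lemma weak_solution_eq v tau : sqmod v < 64^-1 -> sqmod tau < 4^-1 ->
  weak_solution (@phi R) (Some v, tau) = (- fs_pot v)%:E.
Proof.
move=> v8 t2; apply/eqP; rewrite eq_le; apply/andP; split.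
  apply: ub_ereal_sup => _ [psi cpsi <-].
  have [b b4 bE] := leaf_through v8 t2.
  have ct : closed_disc tau by rewrite /closed_disc/=; lra.
  have := competitor_leaf_le0 cpsi b4 ct; rewrite bE /twist /chart_prod/=.
  by rewrite EFinN -leeBrDl ?sub0e.
apply/lee_addgt0Pr => d d0.
(* The competitor [lower e] falls short of [- fs_pot v] by at most ln (1 + 2e) <= 2e <= d. *)
pose e := Num.min (expR (- 1) / 4) (d / 2).
have e0 : 0 < e by rewrite lt_min !divr_gt0 ?expR_gt0.
have ele : e <= expR (- 1) / 4 by rewrite ge_min lexx.
have ed : e <= d / 2 by rewrite ge_min lexx orbT.
have h : (lower e (Some v, tau) <= weak_solution (@phi R) (Some v, tau))%E.
  by apply: ereal_sup_ubound; exists (lower e) => //; exact: competitor_lower.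
apply: le_trans (leeD2r _ h); rewrite /lower -EFinD lee_fin /=.
have n0 : 0 < 1 + e * sqmod v by rewrite ltr_pwDl// mulr_ge0 ?sqmod_ge0// ltW.
have d1 : 0 < 1 + 2 * e by lra.
rewrite ln_div ?posrE//.
have h1 : 0 <= ln (1 + e * sqmod v) by rewrite ln_ge0// lerDl mulr_ge0 ?sqmod_ge0// ltW.
have h2 : ln (1 + 2 * e) <= 2 * e by apply: le_ln1Dx; lra.
lra.
Qed.

End envelope.

Theorem theorem1p1 (R : realType) :
  exists phi : plane R -> P1 R -> R,
    [/\ smooth_family phi,
        forall tau, circle tau -> kahler_potential (phi tau) &
        exists S : set (P1 R * plane R),
          [/\ open S, S !=set0, S `<=` [set p | disc p.2] &
              completely_degenerate (weak_solution phi) S]].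
Proof.
have open_sqmod (M : R) : open [set z : plane R | sqmod z < M].
  rewrite (_ : [set z : plane R | _] = @sqmod R @^-1` [set t | t < M])//.
  by apply: open_comp => [z _|]; [exact: continuous_sqmod|exact: open_lt].
have sqmod0 : sqmod (0 : plane R) = 0 by rewrite /sqmod/= expr0n/= addr0.
exists (@phi R); split; [exact: smooth_family_phi|exact: kahler_potential_phi|].
pose V : set (P1 R) := Some @` [set v : plane R | sqmod v < 64^-1].
exists (fst @^-1` V `&` snd @^-1` [set tau | sqmod tau < 4^-1]); split.
- apply: openI; apply: open_comp => [p _|].
  + exact: cvg_fst.
  + exact: one_point_compactification_open_some.
  + exact: cvg_snd.
  + exact: open_sqmod.
- exists (Some 0 : P1 R, 0); split; last by rewrite /= sqmod0.
  by exists 0 => //=; rewrite sqmod0.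
- by move=> p [_ /= h]; rewrite /disc/=; lra.
(* In the affine chart the local potential of the envelope is identically 0 on the set. *)
case; last first.
  apply: current_eq0_cst0 => -[w tau] [[v /= v8 [<-]] t2].
  by rewrite /twist /chart_prod /= weak_solution_eq// -EFinD subrr.
(* Seen from infinity the set lies in |w|^2 > 64, away from w = 0, and the local potential there is
   the pluriharmonic ln |w|^2. *)
have chartE w tau : V (chart true w) -> sqmod tau < 4^-1 ->
    64 < sqmod w /\ twist (weak_solution (@phi R)) true (w, tau) = (ln (sqmod w))%:E.
  rewrite /twist /chart_prod /=; case: eqVneq => [_ [? _ //]|w0] [v /= v8 [vE]] t2.
  have s0 : 0 < sqmod w by rewrite sqmod_gt0.
  rewrite vE sqmod_cinv in v8; split; first by rewrite -ltf_pV2 ?posrE.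
  rewrite weak_solution_eq ?sqmod_cinv// -EFinD /fs_pot sqmod_cinv; congr (_%:E).
  have i0 : 0 < (sqmod w)^-1 by rewrite invr_gt0.
  have c0 : 0 < 1 + (sqmod w)^-1 by rewrite addr_gt0.
  have -> : 1 + sqmod w = sqmod w * (1 + (sqmod w)^-1) by field; rewrite gt_eqF.
  by rewrite lnM ?posrE// addrK.
apply: (@current_eq0_ln _ _ _ 1) => // -[w tau] [/chartE h] /h [s64 E //].
by rewrite mulr1; apply: le_trans (ltW s64); lra.
Qed.
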